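(* Take any integer $d\ge 1$. Let $X_1,X_2,\ldots$ be i.i.d. $\mathbb{R}^d$-valued random vectors with probability density in either $\mathcal{P}(d)$ or $\mathcal{P}^+(d)$. Let $r>0$ be fixed, and for each $n\ge 1$ let $f_n:(\mathbb{R}^d)^n\to\mathbb{R}$ be a measurable function such that for all $\lambda\ge 0$ and all $x_1,\ldots,x_n\in\mathbb{R}^d$, $$f_n(\lambda x_1,\ldots,\lambda x_n)=\lambda^r f_n(x_1,\ldots,x_n).$$ Let $L_n:=f_n(X_1,\ldots,X_n)$. Let $(t_n)_{n\ge1}$ be a sequence of positive real numbers such that $$\liminf_{n\to\infty}\mathbb{P}(L_n\ge t_n)>0.$$ Then $L_n$ has fluctuations of order at least $n^{-1/2}t_n$.
   Context: Fluctuations: for a sequence of random variables $\{X_n\}$ and a sequence of positive real numbers $\{\delta_n\}$, we say that $X_n$ has fluctuations of order at least $\delta_n$ if there are positive constants $c_1,c_2$ such that for all large $n$, and for all $-\infty<a\le b<\infty$ with $b-a\le c_1\delta_n$, $\mathbb{P}(a\le X_n\le b)\le 1-c_2$. Class $\mathcal{P}(d)$: the set of all probability densities of the form $e^{-V}$ on $\mathbb{R}^d$, where $V$ is a $C^\infty$ function, $V$ and all its derivatives have at most polynomial growth at infinity, and $e^{V}$ increases faster than any polynomial at infinity. Class $\mathcal{P}^+(d)$: the set of all probability densities of the form $e^{-V}$ on $[0,\infty)^d$, such that $V$ is a $C^\infty$ function in $(0,\infty)^d$, $V$ and all its derivatives have at most polynomial growth at infinity and extend continuously to the boundary of $[0,\infty)^d$,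 and $e^{V}$ increases faster than any polynomial at infinity. *)

(* Defs.v *)
From HB Require Import structures.
From mathcomp Require Import all_boot all_order all_algebra.
From mathcomp Require Import all_classical all_reals all_analysis.

Set Implicit Arguments.
Unset Strict Implicit.
Unset Printing Implicit Defensive.

Import Order.TTheory GRing.Theory Num.Theory.
Import numFieldNormedType.Exports.

Local Open Scope classical_set_scope.
Local Open Scope ring_scope.

(* R^d is 'rV[R]_d. Its sigma-algebra is the one generated by the coordinates,
   i.e., the product of the Borel sigma-algebras, which is also the Borel
   sigma-algebra of R^d. *)
Definition rV_display : measure_display.
Proof. exact: default_measure_display. Qed.

Section measurable_rV.
Context {R : realType} (d : nat).

Definition rV_coord (i : 'I_d) (x : 'rV[R]_d) : R := x ord0 i.

Let rV_set0 : g_sigma_preimage rV_coord set0.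
Proof. exact: sigma_algebra0. Qed.

Let rV_setC A : g_sigma_preimage rV_coord A -> g_sigma_preimage rV_coord (~` A).
Proof. exact: sigma_algebraC. Qed.

Let rV_bigcup (F : (set 'rV[R]_d)^nat) :
  (forall i, g_sigma_preimage rV_coord (F i)) ->
  g_sigma_preimage rV_coord (\bigcup_i (F i)).
Proof. exact: sigma_algebra_bigcup. Qed.

HB.instance Definition _ :=
  @isMeasurable.Build rV_display
    'rV[R]_d (g_sigma_preimage rV_coord) rV_set0 rV_setC rV_bigcup.
End measurable_rV.

Lemma measurable_rV_coord (R : realType) n (i : 'I_n) :
  measurable_fun [set: 'rV[R]_n] (fun x : 'rV[R]_n => x ord0 i).
Proof.
move=> _ Y mY; rewrite setTI; apply: sub_sigma_algebra => /=.
rewrite -bigcup_seq/=; exists i => /=; first by rewrite mem_index_enum.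
by exists Y => //; rewrite setTI.
Qed.

Lemma measurable_rVP (R : realType) d (T : measurableType d) n
    (f : T -> 'rV[R]_n) :
  measurable_fun [set: T] f <->
  forall i, measurable_fun [set: T] (fun t => f t ord0 i).
Proof.
split=> [mf i|mf _ Y mY].
  exact: (measurableT_comp (@measurable_rV_coord R n i) mf).
rewrite setTI.
have : g_sigma_preimage (fun i => @rV_coord R n i \o f) `<=` measurable.
  apply: smallest_sub; first exact: sigma_algebra_measurable.
  rewrite -bigcup_seq => B [i _ [A mA <-]]; exact: (mf i).
apply; rewrite g_sigma_preimage_comp.
by exists Y => //; rewrite setTI.
Qed.

(* Lebesgue measure on R^d, by recursion on d: a unit mass on the point space
   R^0, and the product of the measures of R and R^d, carried to R^(d+1) by
   (a, x) |-> (a, x_1, ..., x_d). *)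
Section rV_cons.
Context {R : realType} {d : nat}.

Definition rV_cons (p : measurableTypeR R * 'rV[R]_d) : 'rV[R]_d.+1 :=
  \row_i oapp (fun j => p.2 ord0 j) p.1 (unlift ord0 i).

Definition rV_uncons (x : 'rV[R]_d.+1) : measurableTypeR R * 'rV[R]_d :=
  (x ord0 ord0, \row_j x ord0 (lift ord0 j)).

Lemma rV_consK : cancel rV_cons rV_uncons.
Proof.
case=> a x; rewrite /rV_uncons /rV_cons !mxE unlift_none/=; congr pair.
by apply/rowP => j; rewrite !mxE liftK.
Qed.

Lemma measurable_rV_cons : measurable_fun [set: measurableTypeR R * 'rV[R]_d] rV_cons.
Proof.
apply/measurable_rVP => i; under eq_fun do rewrite mxE.
case: (unlift ord0 i) => [j|] /=; last exact: measurable_fst.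
exact: (measurableT_comp (@measurable_rV_coord R d j) measurable_snd).
Qed.

Lemma measurable_rV_uncons : measurable_fun [set: 'rV[R]_d.+1] rV_uncons.
Proof.
apply/measurable_fun_pairP; split; first exact: measurable_rV_coord.
apply/measurable_rVP => j; rewrite /comp/=; under eq_fun do rewrite mxE.
exact: measurable_rV_coord.
Qed.

Let mu1 := @lebesgue_measure R.
Variable m : {sigma_finite_measure set 'rV[R]_d -> \bar R}.

Definition lebesgue_cons : set 'rV[R]_d.+1 -> \bar R :=
  pushforward (mu1 \x m)%E rV_cons.

Let lebesgue_cons0 : lebesgue_cons set0 = 0%E.
Proof. by rewrite /lebesgue_cons /pushforward preimage_set0 measure0. Qed.

Let lebesgue_cons_ge0 A : (0 <= lebesgue_cons A)%E.
Proof. by rewrite /lebesgue_cons /pushforward; exact: measure_ge0. Qed.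

Let lebesgue_cons_sigma_additive : semi_sigma_additive lebesgue_cons.
Proof.
exact: (@measure_semi_sigma_additive _ _ _
  (measure_function_pushforward__canonical__measure_function_Measure
    (mu1 \x m)%E measurable_rV_cons)).
Qed.

HB.instance Definition _ := isMeasure.Build _ _ _ lebesgue_cons
  lebesgue_cons0 lebesgue_cons_ge0 lebesgue_cons_sigma_additive.

Let lebesgue_cons_sigma_finite : sigma_finite setT lebesgue_cons.
Proof.
have /sigma_finiteP[F [TF ndF Foo]] := sigma_finiteT mu1.
have /sigma_finiteP[G [TG ndG Goo]] := sigma_finiteT m.
exists (fun k => rV_uncons @^-1` (F k `*` G k)).
  apply/seteqP; split=> // x _.
  have [i _ Fi] : (\bigcup_i F i) (rV_uncons x).1 by rewrite -TF.
  have [j _ Gj] : (\bigcup_j G j) (rV_uncons x).2 by rewrite -TG.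
  exists (maxn i j) => //; split.
    by move: Fi; exact/subsetPset/ndF/leq_maxl.
  by move: Gj; exact/subsetPset/ndG/leq_maxr.
move=> k; have [mF Fk] := Foo k; have [mG Gk] := Goo k; split.
  rewrite -[X in measurable X]setTI.
  by apply: measurable_rV_uncons => //; exact: measurableX.
rewrite /lebesgue_cons /pushforward -comp_preimage.
rewrite (_ : _ \o _ = id); last by apply/funext => p; exact: rV_consK.
by rewrite preimage_id product_measure1E// lte_mul_pinfty// ge0_fin_numE.
Qed.

HB.instance Definition _ := Measure_isSigmaFinite.Build _ _ _ lebesgue_cons
  lebesgue_cons_sigma_finite.
End rV_cons.

Fixpoint lebesgue_rV (R : realType) (d : nat) :
    {sigma_finite_measure set 'rV[R]_d -> \bar R} :=
  if d is d'.+1 then lebesgue_cons (lebesgue_rV R d')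
  else \d_(0 : 'rV[R]_0).

Lemma lebesgue_rV_box (R : realType) d (A : 'I_d -> set (measurableTypeR R)) :
  (forall i, measurable (A i)) ->
  lebesgue_rV R d [set x | forall i, A i (x ord0 i)] =
  (\prod_(i < d) lebesgue_measure (A i))%E.
Proof.
elim: d A => [|d IH] A mA /=.
  by rewrite big_ord0 diracE mem_set// => -[].
pose B := [set x : 'rV[R]_d | forall j, A (lift ord0 j) (x ord0 j)].
have mB : measurable B.
  rewrite (_ : B = \bigcap_(j in [set: 'I_d])
    ((fun x : 'rV[R]_d => x ord0 j) @^-1` A (lift ord0 j))).
    apply: fin_bigcap_measurable => // j _.
    rewrite -[X in measurable X]setTI.
    exact: (@measurable_rV_coord R d j measurableT _ (mA _)).
  by apply/seteqP; split=> x Bx j; [move=> _|]; exact: (Bx j).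
rewrite big_ord_recl -IH// -product_measure1E// /lebesgue_cons /pushforward.
congr ((_ \x _)%E _); apply/seteqP; split=> -[a x] /=.
  move=> Ax; split=> [|j /=].
    by have := Ax ord0; rewrite mxE unlift_none.
  by have := Ax (lift ord0 j); rewrite mxE liftK.
move=> [Aa Bx] i; rewrite mxE.
by case: unliftP => [j|] ->.
Qed.

Definition partial (R : realType) d (i : 'I_d) (V : 'rV[R]_d -> R) :
    'rV[R]_d -> R :=
  fun x => 'D_(delta_mx ord0 i) V x.

Definition iter_partial (R : realType) d (s : seq 'I_d) (V : 'rV[R]_d -> R) :
    'rV[R]_d -> R :=
  foldr (@partial R d) V s.

(* V is C^oo on the open set U. Partial derivatives are limits at the point, so
   on U they do not depend on the values of V outside U. *)
Definition smooth_on (R : realType) d (U : set 'rV[R]_d)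
    (V : 'rV[R]_d -> R) : Prop :=
  forall (s : seq 'I_d) (x : 'rV[R]_d), U x ->
    {for x, continuous (iter_partial s V)} /\
    forall i, derivable (iter_partial s V) x (delta_mx ord0 i).

(* `|x| is the sup norm; all norms on R^d give the same growth conditions. *)
Definition poly_growth_on (R : realType) d (U : set 'rV[R]_d)
    (g : 'rV[R]_d -> R) : Prop :=
  exists (k : nat) (C M : R), forall x, U x -> M <= `|x| ->
    `|g x| <= C * `|x| ^+ k.

Definition exp_superpoly_on (R : realType) d (U : set 'rV[R]_d)
    (V : 'rV[R]_d -> R) : Prop :=
  forall (k : nat) (C : R), exists M : R, forall x, U x -> M <= `|x| ->
    C * `|x| ^+ k <= expR (V x).

Definition pos_orthant (R : realType) d : set 'rV[R]_d :=
  [set x | forall i, 0 < x ord0 i].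

Definition nneg_orthant (R : realType) d : set 'rV[R]_d :=
  [set x | forall i, 0 <= x ord0 i].

Definition extends_to_boundary (R : realType) d (g : 'rV[R]_d -> R) : Prop :=
  exists h : 'rV[R]_d -> R, {within @nneg_orthant R d, continuous h} /\
    forall x, pos_orthant x -> h x = g x.

Definition probability_density (R : realType) d (p : 'rV[R]_d -> R) : Prop :=
  (forall x, 0 <= p x) /\ (\int[lebesgue_rV R d]_x (p x)%:E = 1)%E.

Definition classP (R : realType) d : set ('rV[R]_d -> R) :=
  [set p | probability_density p /\ exists V : 'rV[R]_d -> R,
    [/\ p = (fun x => expR (- V x)),
        smooth_on setT V,
        forall s, poly_growth_on setT (iter_partial s V)
      & exp_superpoly_on setT V]].

(* A density on [0, oo)^d is extended by 0 to R^d. On the boundary of the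
   orthant, V takes the values of its continuous extension. *)
Definition classPplus (R : realType) d : set ('rV[R]_d -> R) :=
  [set p | probability_density p /\ exists V : 'rV[R]_d -> R,
    [/\ p = (fun x => if x \in @nneg_orthant R d
                      then expR (- V x) else 0),
        smooth_on (@pos_orthant R d) V,
        {within @nneg_orthant R d, continuous V},
        forall s, poly_growth_on (@pos_orthant R d) (iter_partial s V) /\
                  extends_to_boundary (iter_partial s V)
      & exp_superpoly_on (@nneg_orthant R d) V]].

Definition has_density (R : realType) (disp : measure_display)
    (T : measurableType disp) (P : probability T R) d
    (X : {RV P >-> 'rV[R]_d}) (p : 'rV[R]_d -> R) : Prop :=
  forall A, measurable A ->
    (distribution P X A = \int[lebesgue_rV R d]_(x in A) (p x)%:E)%E.

(* Mutual independence of the sequence X_0, X_1, ... *)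
Definition independent_seq (R : realType) (disp disp' : measure_display)
    (T : measurableType disp) (T' : measurableType disp') (P : probability T R)
    (X : nat -> {RV P >-> T'}) : Prop :=
  forall (s : seq nat) (A : nat -> set T'), uniq s ->
    (forall i, measurable (A i)) ->
    (P (\bigcap_(i in [set` s]) (X i @^-1` A i)) =
     \prod_(i <- s) P (X i @^-1` A i))%E.

Definition fluctuations_at_least (R : realType) (disp : measure_display)
    (T : measurableType disp) (P : probability T R)
    (Y : nat -> T -> R) (delta : nat -> R) : Prop :=
  exists c1 c2 : R, [/\ 0 < c1, 0 < c2 &
    \forall n \near \oo, forall a b : R, a <= b -> b - a <= c1 * delta n ->
      (P [set w | (a <= Y n w <= b)%R] <= (1 - c2)%:E)%E].

(* Main.v *)
From HB Require Import structures.
Require Import Defs.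
From mathcomp Require Import all_boot all_order all_algebra.
From mathcomp Require Import all_classical all_reals all_analysis.
From mathcomp Require Import measurable_realfun ring lra.

Set Implicit Arguments.
Unset Strict Implicit.
Unset Printing Implicit Defensive.

Import Order.TTheory GRing.Theory Num.Theory.
Import numFieldNormedType.Exports.

Local Open Scope classical_set_scope.
Local Open Scope ring_scope.

(** The idea is to compare the sample (X_1, ..., X_n) with the rescaled sample
    (e^s X_1, ..., e^s X_n) for s = alpha / sqrt n. By homogeneity the statistic
    of the rescaled sample is e^(r s) L_n, which on the event L_n >= t_n exceeds
    L_n by at least r s t_n, a quantity of order t_n / sqrt n. If L_n were
    concentrated on an interval shorter than that, and if the two samples had
    nearly the same law, then both L_n and e^(r s) L_n would belong to this
    interval with probability close to 1, which is impossible on the event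
    L_n >= t_n, whose probability is bounded below.

    The laws of the samples are compared through the Hellinger affinity, the
    integral of the square root z of the density of the law of e^s X_k with
    respect to the law of X_k. For one vector the affinity is at least
    1 - C s^2 ([scale_ratio_affinity]): the square roots of the two densities
    differ by O(s) times a function whose square is integrable, because V has
    polynomially bounded partial derivatives and e^(-V) decays faster than any
    polynomial ([scale_ratio_bound]). For n independent vectors the density and
    the affinity are products ([integral_tail_change], [integral_tail_prod]), so
    that the affinity is at least 1 - n C s^2 = 1 - C alpha^2, uniformly in n.
    Finally an affinity close to 1 makes every event that is likely under the
    first law likely under the second one ([probability_transport]); it remains
    to take alpha small with respect to the lower bound on the probability that
    L_n >= t_n. *)

(** * Integrals with respect to a density *)

Section density.
Import HBNNSimple.

(** For an indicator function this is the hypothesis on nu; simple functions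
    follow by linearity and nonnegative functions by monotone convergence. *)
Lemma ge0_integral_density (disp : measure_display) (T : measurableType disp)
    (R : realType) (mu nu : {measure set T -> \bar R}) (p : T -> R)
    (f : T -> \bar R) :
  measurable_fun setT p -> (forall x, 0 <= p x) ->
  (forall A, measurable A -> nu A = (\int[mu]_(x in A) (p x)%:E)%E) ->
  measurable_fun setT f -> (forall x, (0 <= f x)%E) ->
  (\int[nu]_x f x = \int[mu]_x (f x * (p x)%:E))%E.
Proof.
move=> mp p0 nuE mf f0.
pose h := nnsfun_approx measurableT mf.
have hf x : (h n x)%:E @[n --> \oo] --> f x by exact: cvg_nnsfun_approx.
have nd x : {homo (fun n => (h n x)%:E) : m n / (m <= n)%N >-> (m <= n)%E}.
  by move=> a b ab; rewrite lee_fin; exact/lefP/nd_nnsfun_approx.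
have step n : (\int[nu]_x (h n x)%:E = \int[mu]_x ((h n x)%:E * (p x)%:E))%E.
  have -> : (\int[mu]_x ((h n x)%:E * (p x)%:E) =
      \int[mu]_x (\sum_(y \in range (h n))
        (y * \1_(h n @^-1` [set y]) x)%:E * (p x)%:E))%E.
    apply: eq_integral => x _; rewrite {1}(fimfunE (h n) x) -fsumEFin//.
    rewrite muleC ge0_mule_fsumr; last first.
      by move=> y; rewrite EFinM; exact: nnfun_muleindic_ge0.
    by apply: eq_fsbigr => y _; rewrite muleC.
  rewrite ge0_integral_fsum//; last 2 first.
  - move=> y; apply: emeasurable_funM; last exact/measurable_EFinP.
    by apply/measurable_EFinP/measurable_funM.
  - move=> y x _; apply: mule_ge0; last by rewrite lee_fin.
    by rewrite EFinM; exact: nnfun_muleindic_ge0.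
  transitivity (\int[nu]_x (\sum_(y \in range (h n))
        (y * \1_(h n @^-1` [set y]) x)%:E))%E.
    by apply: eq_integral => x _; rewrite fsumEFin// -fimfunE.
  rewrite ge0_integral_fsum//; last 2 first.
  - by move=> y; apply/measurable_EFinP/measurable_funM.
  - by move=> y x _; rewrite EFinM; exact: nnfun_muleindic_ge0.
  apply: eq_fsbigr => y; rewrite inE => -[x _ yE].
  have y0 : 0 <= y by rewrite -yE.
  have my : measurable (h n @^-1` [set y]) by [].
  rewrite integralZl_indic_nnsfun// integral_indic// setIT nuE//.
  under [RHS]eq_integral do rewrite EFinM -muleA.
  rewrite [RHS]ge0_integralZl_EFin//; last 2 first.
  - by move=> ? _; rewrite mule_ge0// lee_fin.
  - by apply: emeasurable_funM; exact/measurable_EFinP.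
  congr (_ * _)%E; rewrite integral_mkcond.
  apply: eq_integral => u _; rewrite patchE indicE.
  by case: ifPn => _; rewrite ?mul1e ?mul0e.
transitivity (limn (fun n => \int[nu]_x (h n x)%:E))%E.
  rewrite -monotone_convergence//.
  - by apply: eq_integral => x _; apply/esym/cvg_lim => //; exact: hf.
  - by move=> n; exact/measurable_EFinP.
  - by move=> n x _; rewrite lee_fin.
transitivity (limn (fun n => \int[mu]_x ((h n x)%:E * (p x)%:E)))%E.
  by under eq_fun do rewrite step.
rewrite -monotone_convergence//.
- apply: eq_integral => x _; apply/cvg_lim => //.
  rewrite [X in X @ _](_ : _ = fun n => ((p x)%:E * (h n x)%:E)%E); last first.
    by apply/funext => n; rewrite muleC.
  by rewrite muleC; apply: cvgeZl => //; exact: hf.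
- by move=> n; apply: emeasurable_funM; exact/measurable_EFinP.
- by move=> n x _; rewrite mule_ge0// lee_fin.
- by move=> x _ a b ab; rewrite lee_wpmul2r ?lee_fin//; exact: nd.
Qed.

End density.

(** * Independence of a sample and the following ones *)

Section tail.
Context (R : realType) (dT dE : measure_display) (T : measurableType dT)
  (E : measurableType dE) (P : probability T R).

(** The offset m serves the inductions on n: removing the sample X m leaves a
    block of the same form that starts at m + 1. *)
Definition tail_tuple (X : nat -> {RV P >-> E}) (m n : nat) (w : T) :
  n.-tuple E := [tuple X (m + i)%N w | i < n].

Lemma measurable_tail_tuple (X : nat -> {RV P >-> E}) m n :
  measurable_fun setT (tail_tuple X m n).
Proof.
apply/measurable_fun_tnthP => i.
rewrite (_ : _ \o _ = X (m + i)%N); first exact: measurable_funP.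
by apply/funext => w /=; rewrite tnth_mktuple.
Qed.

Lemma tail_tupleS (X : nat -> {RV P >-> E}) m n w :
  tail_tuple X m n.+1 w = [tuple of X m w :: tail_tuple X m.+1 n w].
Proof.
apply/eq_from_tnth => i; rewrite tnth_mktuple.
case: (unliftP ord0 i) => [j|] ->; rewrite ?tnthS ?tnth0 ?addn0//.
by rewrite tnth_mktuple /= /bump /= add1n addnS.
Qed.

(** Boxes are cut out by a sequence of sets indexed by nat, and not by 'I_n,
    because independence is a statement about such sequences. *)
Definition tuple_boxes n : set (set (n.-tuple E)) :=
  [set B | exists A : nat -> set E, (forall i, measurable (A i)) /\
    B = [set t : n.-tuple E | forall i : 'I_n, A i (tnth t i)]].

Lemma measurable_tuple_boxes n :
  (@measurable _ (n.-tuple E)) = <<s @tuple_boxes n >>.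
Proof.
apply/seteqP; split.
  apply: smallest_sub; first exact: smallest_sigma_algebra.
  move=> B /=; rewrite -bigcup_seq /= => -[i _ [A mA <-]].
  apply: sub_sigma_algebra; exists (fun k => if k == i :> nat then A else setT).
  split=> [k|]; first by case: ifP.
  rewrite setTI; apply/seteqP; split=> t /=.
    by move=> At j; case: eqP => // ji; rewrite (val_inj ji).
  by move=> /(_ i); rewrite eqxx.
apply: smallest_sub; first exact: sigma_algebra_measurable.
move=> _ [A [mA ->]].
rewrite (_ : [set _ | _] = \bigcap_(i in [set: 'I_n])
   ((fun t : n.-tuple E => tnth t i) @^-1` A i)); last first.
  by apply/seteqP; split=> t At i; [move=> _|]; exact: At.
apply: fin_bigcap_measurable => // i _.
by rewrite -[X in measurable X]setTI; exact: (@measurable_tnth _ E n i).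
Qed.

(** Independence speaks of boxes only. For a fixed A both sides are finite
    measures of B, and the boxes form a generating pi-system, so that equality
    on boxes suffices. *)
Lemma independent_head_tail (X : nat -> {RV P >-> E}) m n
    (A : set E) (B : set (n.-tuple E)) :
  independent_seq X -> measurable A -> measurable B ->
  (P (X m @^-1` A `&` tail_tuple X m.+1 n @^-1` B) =
   P (X m @^-1` A) * P (tail_tuple X m.+1 n @^-1` B))%E.
Proof.
move=> indX mA mB.
have mXA : measurable (X m @^-1` A).
  by rewrite -[X in measurable X]setTI; exact: measurable_funP.
have mt := @measurable_tail_tuple X m.+1 n.
pose mt' := isMeasurableFun.Build _ _ _ _ _ mt.
pose tl : {mfun T >-> n.-tuple E} := HB.pack (tail_tuple X m.+1 n) mt'.
pose m1 : {measure set (n.-tuple E) -> \bar R} :=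
  measure_function_pushforward__canonical__measure_function_Measure
    (mrestr P mXA) mt.
have fP : P (X m @^-1` A) \is a fin_num by exact: fin_num_measure.
have f0 : 0 <= fine (P (X m @^-1` A)) by exact/fine_ge0.
pose m2 : {measure set (n.-tuple E) -> \bar R} :=
  mscale (NngNum f0) (distribution P tl).
have -> : (P (X m @^-1` A `&` tail_tuple X m.+1 n @^-1` B) = m1 B)%E.
  by rewrite /m1 /= /pushforward /mrestr setIC.
have -> : (P (X m @^-1` A) * P (tail_tuple X m.+1 n @^-1` B) = m2 B)%E.
  by rewrite /m2 /= /mscale /= /pushforward fineK.
apply: (measure_unique (@tuple_boxes n) (fun=> setT)) => //.
- exact: measurable_tuple_boxes.
- move=> _ _ [A1 [mA1 ->]] [A2 [mA2 ->]].
  exists (fun i => A1 i `&` A2 i); split=> [i|]; first exact: measurableI.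
  apply/seteqP; split=> t /=; first by case=> h1 h2 i; split.
  by move=> h; split=> i; have [] := h i.
- move=> _; exists (fun=> setT); split=> //.
  by apply/seteqP; split.
- by apply/seteqP; split=> // t _; exists 0%N.
- move=> _ [D [mD ->]].
  pose D' k := if k == m then A else D (k - m.+1)%N.
  have mD' k : measurable (D' k) by rewrite /D'; case: ifP.
  have tlE : tl @^-1` [set t : n.-tuple E | forall i : 'I_n, D i (tnth t i)] =
      \bigcap_(k in [set` iota m.+1 n]) (X k @^-1` D' k).
    apply/seteqP; split=> w /=.
      move=> Dt k /=; rewrite mem_iota => /andP[mk kn].
      have kmn : (k - m.+1 < n)%N by rewrite ltn_subLR.
      rewrite /D' gtn_eqF//; have := Dt (Ordinal kmn).
      by rewrite tnth_mktuple /= subnKC.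
    move=> Dk i; have := Dk (m.+1 + i)%N; rewrite /= mem_iota leq_addr ltn_add2l.
    move=> /(_ (ltn_ord i)).
    by rewrite /D' gtn_eqF ?leq_addr// tnth_mktuple addKn.
  rewrite /m1 /m2 /= /pushforward /mrestr /mscale /= fineK//.
  rewrite /distribution /pushforward tlE.
  have -> : \bigcap_(k in [set` iota m.+1 n]) (X k @^-1` D' k) `&` X m @^-1` A =
     \bigcap_(k in [set` iota m n.+1]) (X k @^-1` D' k).
    have Dm : D' m = A by rewrite /D' eqxx.
    apply/seteqP; split=> w /=.
      move=> [h1 h2] k /=; rewrite inE => /predU1P[->|]; last exact: h1.
      by rewrite Dm.
    move=> h; split=> [k /= kn|]; first by apply: h; rewrite /= inE kn orbT.
    by rewrite -Dm; apply: h; rewrite /= inE eqxx.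
  rewrite indX ?iota_uniq// indX ?iota_uniq//=.
  by rewrite big_cons /D' eqxx.
- move=> _; rewrite /m1 /= /pushforward /mrestr.
  by rewrite (le_lt_trans (probability_le1 _ _))// ?ltry// preimage_setT setTI.
Qed.

(** The law of the pair is the product of the two laws, and Tonelli's theorem
    applies. Writing the right-hand side as a double integral over T, that is,
    with two copies of the probability space, makes it possible to exchange the
    two integrals later on without naming the laws. *)
Lemma integral_head_tail (X : nat -> {RV P >-> E}) m n
    (F : E * n.-tuple E -> \bar R) :
  independent_seq X -> measurable_fun setT F -> (forall x, (0 <= F x)%E) ->
  (\int[P]_w F (X m w, tail_tuple X m.+1 n w) =
   \int[P]_w \int[P]_v F (X m w, tail_tuple X m.+1 n v))%E.
Proof.
move=> indX mF F0.
have mX : measurable_fun setT (X m) by exact: measurable_funP.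
have mt := @measurable_tail_tuple X m.+1 n.
pose mt' := isMeasurableFun.Build _ _ _ _ _ mt.
pose tl : {mfun T >-> n.-tuple E} := HB.pack (tail_tuple X m.+1 n) mt'.
have mp : measurable_fun setT (fun w => (X m w, tl w)).
  by apply/measurable_fun_pairP; split.
pose mp' := isMeasurableFun.Build _ _ _ _ _ mp.
pose pr : {mfun T >-> (E * n.-tuple E)%type} := HB.pack (fun w => (X m w, tl w)) mp'.
transitivity (\int[distribution P pr]_z F z)%E.
  by rewrite ge0_integral_distribution.
pose P1 : probability E R := distribution P (X m).
pose P2 : probability (n.-tuple E) R := distribution P tl.
transitivity (\int[(P1 \x P2)%E]_z F z)%E.
  apply: eq_measure_integral => A mA _.
  apply/esym/product_measure_unique => // B C mB mC.
  exact: independent_head_tail.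
rewrite (fubini_tonelli1 F)//.
transitivity (\int[P]_w fubini_F P2 F (X m w))%E.
  rewrite /P1 ge0_integral_distribution//.
  - exact: (measurable_fun_fubini_tonelli_F F).
  - by move=> x; apply: integral_ge0.
apply: eq_integral => w _; rewrite /fubini_F /P2 ge0_integral_distribution//.
exact: measurableT_comp.
Qed.
End tail.

(** * Change of measure for independent samples *)

Section tuple_change_of_measure.
Context (R : realType) (dT dE : measure_display) (T : measurableType dT)
  (E : measurableType dE) (P : probability T R).

Definition tuple_apply (S : E -> E) n (t : n.-tuple E) : n.-tuple E :=
  [tuple S (tnth t i) | i < n].

Definition tuple_prod (z : E -> R) n (t : n.-tuple E) : R :=
  \prod_(i < n) z (tnth t i).

Lemma tuple_apply_cons S n x (t : n.-tuple E) :
  tuple_apply S [tuple of x :: t] = [tuple of S x :: tuple_apply S t].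
Proof.
apply/eq_from_tnth => i; rewrite tnth_mktuple.
by case: (unliftP ord0 i) => [j|] ->; rewrite ?tnthS ?tnth0// tnth_mktuple.
Qed.

Lemma tuple_prod_cons z n x (t : n.-tuple E) :
  tuple_prod z [tuple of x :: t] = z x * tuple_prod z t.
Proof.
rewrite /tuple_prod big_ord_recl tnth0; congr (_ * _).
by apply: eq_bigr => i _; rewrite tnthS.
Qed.

Lemma measurable_tuple_apply S n :
  measurable_fun setT S -> measurable_fun setT (@tuple_apply S n).
Proof.
move=> mS; apply/measurable_fun_tnthP => i.
rewrite (_ : _ \o _ = S \o (fun t => tnth t i)).
  by apply: measurableT_comp => //; exact: measurable_tnth.
by apply/funext => t /=; rewrite tnth_mktuple.
Qed.

Lemma measurable_tuple_prod (z : E -> R) n :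
  measurable_fun setT z -> measurable_fun setT (@tuple_prod z n).
Proof.
move=> mz; apply: measurable_prod => i _.
by apply: (measurableT_comp mz); exact: measurable_tnth.
Qed.

Lemma tuple_prod_ge0 (z : E -> R) n (t : n.-tuple E) :
  (forall x, 0 <= z x) -> 0 <= tuple_prod z t.
Proof. by move=> z0; apply: prodr_ge0. Qed.

Context (X : nat -> {RV P >-> E}) (z : E -> R).
Hypothesis indX : independent_seq X.
Hypothesis mz : measurable_fun setT z.
Hypothesis z0 : forall x, 0 <= z x.

Let mcons n : measurable_fun setT
  (fun xt : E * n.-tuple E => [tuple of xt.1 :: xt.2]).
Proof. exact: measurable_cons. Qed.

(** Densities tensorize: if z ^+ 2 is the density of the law of S (X k) with
    respect to the law of X k, then the product of the z ^+ 2 is the density for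
    a block of n independent samples. The block is split into its first sample
    and the rest; the induction hypothesis transforms the inner integral and,
    after an exchange of the integrals, the hypothesis on z the other one. *)
Lemma integral_tail_change (S : E -> E) :
  measurable_fun setT S ->
  (forall k (g : E -> \bar R), measurable_fun setT g ->
    (forall x, (0 <= g x)%E) ->
    (\int[P]_w g (S (X k w)) =
     \int[P]_w (g (X k w) * (z (X k w) ^+ 2)%:E))%E) ->
  forall n m (F : n.-tuple E -> \bar R), measurable_fun setT F ->
    (forall x, (0 <= F x)%E) ->
    (\int[P]_w F (tuple_apply S (tail_tuple X m n w)) =
     \int[P]_w (F (tail_tuple X m n w) *
                (tuple_prod z (tail_tuple X m n w) ^+ 2)%:E))%E.
Proof.
move=> mS hS; elim=> [|n IH] m F mF F0.
  apply: eq_integral => w _; rewrite /tuple_prod big_ord0 expr1n mule1.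
  by congr F; apply/eq_from_tnth => -[].
have mX : measurable_fun setT (X m) by exact: measurable_funP.
have mt := @measurable_tail_tuple _ _ _ _ _ _ X m.+1 n.
have mzX : measurable_fun setT (fun w => z (X m w)).
  exact: measurableT_comp.
have mZ := @measurable_tuple_prod z n mz.
have mZt : measurable_fun setT (fun w => tuple_prod z (tail_tuple X m.+1 n w)).
  exact: measurableT_comp.
have mFc : measurable_fun setT
    (fun xt : E * n.-tuple E => F [tuple of xt.1 :: xt.2]).
  exact: (measurableT_comp mF (@mcons n)).
transitivity (\int[P]_w \int[P]_v
    F [tuple of S (X m w) :: tuple_apply S (tail_tuple X m.+1 n v)])%E.
  under eq_integral do rewrite tail_tupleS tuple_apply_cons.
  rewrite (@integral_head_tail _ _ _ _ _ _ X m n (fun xt : E * n.-tuple E =>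
    F [tuple of S xt.1 :: tuple_apply S xt.2]))//.
  apply: (measurableT_comp mF); apply: measurable_cons.
    exact: measurableT_comp.
  by apply: measurableT_comp => //; exact: measurable_tuple_apply.
transitivity (\int[P]_w \int[P]_v
    (F [tuple of S (X m w) :: tail_tuple X m.+1 n v] *
     (tuple_prod z (tail_tuple X m.+1 n v) ^+ 2)%:E))%E.
  apply: eq_integral => w _.
  rewrite (IH m.+1 (fun t => F [tuple of S (X m w) :: t]))//.
  by apply: (measurableT_comp mF); exact: measurable_cons.
transitivity (\int[P]_v \int[P]_w
    (F [tuple of S (X m w) :: tail_tuple X m.+1 n v] *
     (tuple_prod z (tail_tuple X m.+1 n v) ^+ 2)%:E))%E.
  rewrite (fubini_tonelli (fun wv : T * T =>
    (F [tuple of S (X m wv.1) :: tail_tuple X m.+1 n wv.2] *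
     (tuple_prod z (tail_tuple X m.+1 n wv.2) ^+ 2)%:E)%E))//; last first.
    by move=> wv; rewrite mule_ge0// lee_fin sqr_ge0.
  apply: emeasurable_funM.
    apply: (measurableT_comp mF); apply: measurable_cons.
      by apply: (measurableT_comp mS); exact: measurableT_comp.
    exact: measurableT_comp.
  apply/measurable_EFinP; apply: measurable_funX.
  exact: (measurableT_comp mZt).
transitivity (\int[P]_v \int[P]_w
    (F [tuple of X m w :: tail_tuple X m.+1 n v] *
     (tuple_prod z (tail_tuple X m.+1 n v) ^+ 2)%:E *
     (z (X m w) ^+ 2)%:E))%E.
  apply: eq_integral => v _.
  rewrite (hS m (fun x => F [tuple of x :: tail_tuple X m.+1 n v] *
     (tuple_prod z (tail_tuple X m.+1 n v) ^+ 2)%:E)%E)//.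
    apply: emeasurable_funM => //.
    by apply: (measurableT_comp mF); exact: measurable_cons.
  by move=> x; rewrite mule_ge0// lee_fin sqr_ge0.
pose H (xt : E * n.-tuple E) := (F [tuple of xt.1 :: xt.2] *
     (tuple_prod z xt.2 ^+ 2)%:E * (z xt.1 ^+ 2)%:E)%E.
have mH : measurable_fun setT H.
  apply: emeasurable_funM; first apply: emeasurable_funM => //.
    apply/measurable_EFinP; apply: measurable_funX.
    exact: (measurableT_comp mZ).
  apply/measurable_EFinP; apply: measurable_funX.
  exact: (measurableT_comp mz).
have H0 xt : (0 <= H xt)%E by rewrite !mule_ge0// lee_fin sqr_ge0.
transitivity (\int[P]_w H (X m w, tail_tuple X m.+1 n w))%E; last first.
  apply: eq_integral => w _; rewrite tail_tupleS tuple_prod_cons /H/=.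
  by rewrite -muleA -EFinM exprMn mulrC.
apply/esym/(eq_trans (@integral_head_tail _ _ _ _ _ _ X m n H indX mH H0)).
apply: (fubini_tonelli (fun wv : T * T =>
  H (X m wv.1, tail_tuple X m.+1 n wv.2))) => //.
apply: (measurableT_comp mH).
apply/measurable_fun_pairP; split.
  exact: (measurableT_comp mX measurable_fst).
exact: (measurableT_comp mt measurable_snd).
Qed.

(** The affinity, that is, the integral of the square root of the density,
    tensorizes too. This is what makes the squared Hellinger distance grow only
    linearly with the number of samples. *)
Lemma integral_tail_prod (h : R) :
  (forall k, (\int[P]_w (z (X k w))%:E = h%:E)%E) ->
  forall n m, (\int[P]_w (tuple_prod z (tail_tuple X m n w))%:E = (h ^+ n)%:E)%E.
Proof.
move=> hz; elim=> [|n IH] m.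
  under eq_integral do rewrite /tuple_prod big_ord0.
  rewrite (integral_cst P measurableT 1) mul1e expr0.
  exact: probability_setT.
have mX : measurable_fun setT (X m) by exact: measurable_funP.
have mZ := @measurable_tuple_prod z n mz.
under eq_integral do rewrite tail_tupleS tuple_prod_cons.
rewrite (@integral_head_tail _ _ _ _ _ _ X m n (fun xt : E * n.-tuple E =>
  (z xt.1 * tuple_prod z xt.2)%:E))//.
- transitivity (\int[P]_w ((z (X m w))%:E * (h ^+ n)%:E))%E.
    apply: eq_integral => w _ /=; rewrite -(IH m.+1).
    under eq_integral do rewrite EFinM.
    rewrite ge0_integralZl_EFin//.
    + by move=> v _; rewrite lee_fin tuple_prod_ge0.
    + apply/measurable_EFinP; apply: (measurableT_comp mZ).
      exact: measurable_tail_tuple.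
  rewrite ge0_integralZr ?hz//.
  + by rewrite -EFinM exprS.
  + by apply/measurable_EFinP; exact: measurableT_comp.
  + by move=> w _; rewrite lee_fin.
  + rewrite lee_fin exprn_ge0// -lee_fin -(hz 0%N).
    by apply: integral_ge0 => w _; rewrite lee_fin.
- apply/measurable_EFinP; apply: measurable_funM.
  + exact: (measurableT_comp mz).
  + exact: (measurableT_comp mZ).
- by move=> xt; rewrite lee_fin mulr_ge0// tuple_prod_ge0.
Qed.
End tuple_change_of_measure.

(** * Lebesgue measure of row vectors under scaling *)

Section scaling.
Context (R : realType).
Implicit Types (c : R) (d : nat).

Lemma measurable_rV_scale d c :
  measurable_fun setT (fun x : 'rV[R]_d => c *: x).
Proof.
apply/measurable_rVP => i; under eq_fun do rewrite mxE.
by apply: measurable_funM => //; exact: measurable_rV_coord.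
Qed.

Lemma lebesgue_measure_scale c (A : set (measurableTypeR R)) : 0 < c ->
  measurable A ->
  lebesgue_measure A = (c%:E * lebesgue_measure ( *%R c @^-1` A))%E.
Proof.
move=> c0 mA.
have mc : measurable_fun setT ( *%R c : measurableTypeR R -> measurableTypeR R).
  exact: measurable_funM.
pose m : {measure set (measurableTypeR R) -> \bar R} :=
  mscale (NngNum (ltW c0))
    (measure_function_pushforward__canonical__measure_function_Measure
       lebesgue_measure mc).
rewrite (lebesgue_measure_unique (mu := m))// => _ [[a b] _ <-].
rewrite /m /= /mscale /= /pushforward /=.
rewrite (_ : _ @^-1` _ = `]a / c, b / c]%classic); last first.
  apply/seteqP; split=> x /=; rewrite !in_itv/= ltr_pdivrMr// ler_pdivlMr//;
    by rewrite [x * c]mulrC.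
rewrite !lebesgue_measure_itv/= !lte_fin ltr_pM2r ?invr_gt0//.
case: ifPn => _; last by rewrite mule0.
by rewrite -!EFinB -EFinM -mulrBl mulrCA divff ?mulr1// gt_eqF.
Qed.

(** Lebesgue measure on R^(d+1) is determined by its values on the rectangles
    B * C with B in R and C in R^d; there the first coordinate contributes a
    factor c and the induction hypothesis a factor c ^+ d. *)
Lemma lebesgue_rV_scale d c (A : set 'rV[R]_d) : 0 < c -> measurable A ->
  lebesgue_rV R d A =
  ((c ^+ d)%:E * lebesgue_rV R d ((fun x => c *: x) @^-1` A))%E.
Proof.
move=> c0; elim: d A => [|d IH] A mA.
  by rewrite expr0 mul1e; congr (lebesgue_rV R 0 _); apply/seteqP;
    split=> x /=; rewrite (_ : c *: x = x)//; apply/rowP => -[].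
pose mu1 := @lebesgue_measure R.
pose sc (p : measurableTypeR R * 'rV[R]_d) : measurableTypeR R * 'rV[R]_d :=
  (c * p.1, c *: p.2).
have msc : measurable_fun setT sc.
  apply/measurable_fun_pairP; split.
    by apply: measurable_funM => //; exact: measurable_fst.
  by apply: (measurableT_comp (@measurable_rV_scale d c)); exact: measurable_snd.
have cd0 : 0 <= c ^+ d.+1 by rewrite exprn_ge0// ltW.
pose m : {measure set (measurableTypeR R * 'rV[R]_d) -> \bar R} :=
  mscale (NngNum cd0)
    (measure_function_pushforward__canonical__measure_function_Measure
       (mu1 \x lebesgue_rV R d)%E msc).
have mB : measurable (@rV_cons R d @^-1` A).
  by rewrite -[X in measurable X]setTI; exact: measurable_rV_cons.
rewrite /= /lebesgue_cons /pushforward.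
rewrite (@product_measure_unique _ _ _ _ _ mu1 (lebesgue_rV R d) m) //.
  rewrite /m /= /mscale /= /pushforward; congr (_ * (_ \x _)%E _)%E.
  apply/seteqP; split=> -[a x] /=; rewrite (_ : rV_cons (sc _) = c *: rV_cons (a, x))//;
    by apply/rowP => i; rewrite !mxE; case: (unlift _ _) => //= j; rewrite mxE.
move=> B C mB' mC; rewrite /m /= /mscale /= /pushforward.
rewrite (_ : sc @^-1` _ = ( *%R c @^-1` B) `*` ((fun x => c *: x) @^-1` C))//.
rewrite product_measure1E//=; last 2 first.
- rewrite -[X in measurable X]setTI.
  have mc : measurable_fun setT ( *%R c : measurableTypeR R -> measurableTypeR R).
    exact: measurable_funM.
  exact: mc.
- by rewrite -[X in measurable X]setTI; exact: measurable_rV_scale.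
by rewrite exprS EFinM muleACA -IH// -lebesgue_measure_scale.
Qed.

Lemma ge0_integral_rV_scale d c (f : 'rV[R]_d -> \bar R) : 0 < c ->
  measurable_fun setT f -> (forall x, (0 <= f x)%E) ->
  (\int[lebesgue_rV R d]_x f x =
   (c ^+ d)%:E * \int[lebesgue_rV R d]_x f (c *: x))%E.
Proof.
move=> c0 mf f0.
have cd0 : 0 <= c ^+ d by rewrite exprn_ge0// ltW.
pose m1 : {measure set 'rV[R]_d -> \bar R} :=
  measure_function_pushforward__canonical__measure_function_Measure
    (lebesgue_rV R d) (@measurable_rV_scale d c).
pose m : {measure set 'rV[R]_d -> \bar R} := mscale (NngNum cd0) m1.
transitivity (\int[m]_x f x)%E.
  by apply: eq_measure_integral => A mA _; exact: lebesgue_rV_scale.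
rewrite ge0_integral_mscale//=; congr (_ * _)%E.
by rewrite ge0_integral_pushforward//; exact: measurable_rV_scale.
Qed.

End scaling.

Section rV_integrals.
Context (R : realType).

Lemma measurable_rV_cube d (B : 'I_d -> set R) :
  (forall i, measurable (B i)) ->
  measurable [set x : 'rV[R]_d | forall i, B i (x ord0 i)].
Proof.
move=> mB; rewrite (_ : [set _ | _] = \bigcap_(i in [set: 'I_d])
   ((fun x : 'rV[R]_d => x ord0 i) @^-1` B i)); last first.
  by apply/seteqP; split=> t Bt i; [move=> _|]; exact: Bt.
apply: fin_bigcap_measurable => // i _.
rewrite -[X in measurable X]setTI.
exact: (@measurable_rV_coord R d i measurableT _ (mB i)).
Qed.

(** These hyperplanes cover the boundary of the orthant. *)
Lemma lebesgue_rV_hyperplane d (i : 'I_d) :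
  lebesgue_rV R d [set x | x ord0 i = 0] = 0%E.
Proof.
pose A (j : 'I_d) : set (measurableTypeR R) := if j == i then [set 0] else setT.
rewrite (_ : [set _ | _] = [set x | forall j, A j (x ord0 j)]); last first.
  apply/seteqP; split=> x /=; rewrite /A.
    by move=> x0 j; case: eqP => // ->.
  by move=> /(_ i); rewrite eqxx.
rewrite lebesgue_rV_box; last by move=> j; rewrite /A; case: ifP.
by rewrite (bigD1 i)//= /A eqxx lebesgue_measure_set1 mul0e.
Qed.

(** With w t = (1 + t ^+ 2)^-1 this gives an integrable majorant on R^d. *)
Lemma integral_rV_prod d (w : R -> R) (I : R) :
  measurable_fun setT w -> (forall x, 0 <= w x) ->
  (\int[@lebesgue_measure R]_x (w x)%:E = I%:E)%E ->
  (\int[lebesgue_rV R d]_x (\prod_(i < d) w (x ord0 i))%:E = (I ^+ d)%:E)%E.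
Proof.
move=> mw w0 wI; elim: d => [|d IH].
  under eq_integral do rewrite big_ord0.
  by rewrite /= integral_cst//= diracT mule1 expr0.
have mp k : measurable_fun setT
    (fun x : 'rV[R]_k => (\prod_(i < k) w (x ord0 i))%:E).
  apply/measurable_EFinP; apply: measurable_prod => i _.
  by apply: (measurableT_comp mw); exact: measurable_rV_coord.
have p0 k (x : 'rV[R]_k) : (0 <= (\prod_(i < k) w (x ord0 i))%:E)%E.
  by rewrite lee_fin; apply: prodr_ge0.
rewrite /= (ge0_integral_pushforward (@measurable_rV_cons R d))//; last 2 first.
- exact: (mp d.+1).
- by move=> x _; exact: p0.
rewrite preimage_setT /=.
transitivity (\int[@lebesgue_measure R \x lebesgue_rV R d]_z
   ((w z.1)%:E * (\prod_(i < d) w (z.2 ord0 i))%:E))%E.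
  apply: eq_integral => -[a x] _ /=; rewrite big_ord_recl -EFinM; congr _%:E.
  rewrite mxE unlift_none/=; congr (_ * _); apply: eq_bigr => i _.
  by rewrite mxE liftK.
rewrite (fubini_tonelli1 (fun z : measurableTypeR R * 'rV[R]_d =>
  ((w z.1)%:E * (\prod_(i < d) w (z.2 ord0 i))%:E)%E))//=; last 2 first.
- apply: emeasurable_funM; last exact: (measurableT_comp (mp d) measurable_snd).
  by apply/measurable_EFinP; exact: (measurableT_comp mw measurable_fst).
- by move=> z; apply: mule_ge0; [rewrite lee_fin|exact: p0].
rewrite /fubini_F /=.
transitivity (\int[@lebesgue_measure R]_x ((w x)%:E * (I ^+ d)%:E))%E.
  apply: eq_integral => x _; rewrite -IH -ge0_integralZl_EFin//.
  exact: (mp d).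
rewrite ge0_integralZr//; last 3 first.
- exact/measurable_EFinP.
- by move=> x _; rewrite lee_fin.
- by rewrite -IH; apply: integral_ge0.
by rewrite wI -EFinM exprS.
Qed.

Lemma integral_inv_oneDsqr :
  (\int[@lebesgue_measure R]_x ((1 + x ^+ 2)^-1)%:E = (pi : R)%:E)%E.
Proof.
rewrite (ge0_symfun_integralT (f := (fun x => (1 + x ^+ 2)^-1)))//.
- rewrite (_ : [set x : R | 0 <= x] = `[0, +oo[%classic); last first.
    by apply/seteqP; split=> x /=; rewrite in_itv/= andbT.
  by rewrite integral0y_oneDsqr -EFinM mulrC divfK// pnatr_eq0.
- by move=> x; rewrite invr_ge0; rewrite addr_ge0// sqr_ge0.
- exact: continuous_oneDsqrV.
- by move=> x /=; rewrite sqrrN.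
Qed.
End rV_integrals.

(** * Topology and measurability of row vectors *)

Section row_vectors.
Context (R : realType) (d : nat).
Implicit Types (x : 'rV[R]_d) (A D : set 'rV[R]_d) (V : 'rV[R]_d -> R).

Lemma ler_coord_norm x (i : 'I_d) : `|x ord0 i| <= `|x|.
Proof.
by rewrite [leRHS]/Num.Def.normr /= mx_normrE; apply: (le_bigmax _ _ (ord0, i)).
Qed.

Lemma ler_norm_coord x (M : R) :
  0 <= M -> (forall i, `|x ord0 i| <= M) -> `|x| <= M.
Proof.
move=> M0 xM; rewrite [leLHS]/Num.Def.normr /= mx_normrE; apply/bigmax_leP; split=> //.
by case=> i j _ /=; rewrite (ord1 i).
Qed.

Let cube (kz : nat * 'rV[int]_d) : set 'rV[R]_d :=
  [set x | forall i, (kz.2 ord0 i)%:~R <= kz.1.+1%:R * x ord0 i <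
                     (kz.2 ord0 i)%:~R + 1].

(** The sigma-algebra is the one generated by the coordinates, so an open set has
    to be written as a countable union of boxes: it is the union of the cubes
    with side 1 / (k + 1) and corners on the corresponding grid that it
    contains. *)
Lemma open_measurable_rV A : open A -> measurable A.
Proof.
move=> oA.
have mcube kz : measurable (cube kz).
  apply: (@measurable_rV_cube R d (fun i => [set t : R |
    (kz.2 ord0 i)%:~R <= kz.1.+1%:R * t < (kz.2 ord0 i)%:~R + 1])) => i.
  have mM : measurable_fun setT ( *%R (kz.1.+1%:R : R)).
    exact: measurable_funM.
  rewrite (_ : [set _ | _] = setT `&` *%R (kz.1.+1%:R : R) @^-1`
    `[(kz.2 ord0 i)%:~R, (kz.2 ord0 i)%:~R + 1[%classic).
    exact: mM.
  by rewrite setTI; apply/seteqP; split=> t /=; rewrite in_itv.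
rewrite (_ : A = \bigcup_kz if `[< cube kz `<=` A >] then cube kz else set0).
  apply: countable_bigcupT_measurable; first exact: countableP.
  by move=> kz; case: ifP.
apply/seteqP; split=> [x Ax|x [kz _]]; last by case: asboolP => //; apply.
have /nbhs_ballP[e /= e0 xeA] : nbhs x A by exact: open_nbhs_nbhs.
(* The cube of the grid of mesh 1 / (k + 1) that contains x works. *)
have [k ke] : exists k : nat, k.+1%:R^-1 < e.
  exists (Num.truncn e^-1).
  by rewrite invf_plt ?posrE// truncnS_gt.
have k0 : 0 < k.+1%:R :> R by [].
pose kz := (k, \row_i Num.floor (k.+1%:R * x ord0 i)) : nat * 'rV[int]_d.
have xkz : cube kz x.
  by move=> i /=; rewrite mxE floor_le -intrD1 floorD1_gt.
exists kz => //; case: asboolP => [_|nA]; first exact: xkz.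
exfalso; apply: nA => y ykz; apply: xeA.
rewrite -ball_normE /ball_ /=.
apply: le_lt_trans ke; apply: ler_norm_coord => [|i]; first by rewrite invr_ge0.
rewrite !mxE -[leRHS]mul1r ler_pdivlMr//.
rewrite -[X in _ * X]ger0_norm// -normrM mulrC mulrBr.
have /andP[x1 x2] := xkz i; have /andP[y1 y2] := ykz i.
by rewrite ler_norml; apply/andP; split; lra.
Qed.

Lemma continuous_within_measurable D V : measurable D ->
  {within D, continuous V} -> measurable_fun D V.
Proof.
move=> mD /continuousP cV.
apply: (measurability _ (RGenOpens.measurableE R)).
move=> _ [_ [a [b ->] <-]].
have /cV/open_subspaceP[U oU UE] : open `]a, b[%classic by exact: interval_open.
rewrite setIC -UE; apply: measurableI => //; exact: open_measurable_rV.
Qed.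

End row_vectors.

(** * The whole space and the orthant *)

Section cones.
Context (R : realType) (b : bool) (d : nat).
Implicit Types (x : 'rV[R]_d) (g h V : 'rV[R]_d -> R).

(** For b = true the closed and the open cone are the closed and the open
    orthant; for b = false both are the whole space. The boolean lets one proof
    cover both classes of densities. *)
Definition closed_cone : set 'rV[R]_d := [set x | forall i, b -> 0 <= x ord0 i].

Definition open_cone : set 'rV[R]_d := [set x | forall i, b -> 0 < x ord0 i].

Lemma open_cone_closed x : open_cone x -> closed_cone x.
Proof. by move=> xU i /xU /ltW; exact. Qed.

Lemma measurable_closed_cone : measurable closed_cone.
Proof.
apply: (@measurable_rV_cube R d (fun=> [set t : R | b -> 0 <= t])) => _.
case: b.
  rewrite (_ : [set t | _] = `[0, +oo[%classic)//.
  by apply/seteqP; split=> t /=; rewrite in_itv/= andbT => // h; exact: h.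
by rewrite (_ : [set t | _] = setT)//; apply/seteqP; split.
Qed.

Lemma closed_coneZ c x : 0 < c -> closed_cone (c *: x) <-> closed_cone x.
Proof.
move=> c0; split=> xD i bT; have := xD i bT; rewrite mxE.
  by rewrite pmulr_rge0.
by move=> xi; rewrite mulr_ge0// ltW.
Qed.

Lemma compact_cone_ball (M : R) : compact [set x | closed_cone x /\ `|x| <= M].
Proof.
have [M0|M0] := ltP M 0.
  suff -> : [set x | closed_cone x /\ `|x| <= M] = set0 by exact: compact0.
  apply/seteqP; split=> // x [_ xM].
  by have := le_lt_trans xM M0; rewrite normr_lt0.
suff -> : [set x | closed_cone x /\ `|x| <= M] = [set x | forall i,
    `[if b then 0 else - M, M]%classic (x ord0 i)].
  apply: (@rV_compact _ _ (fun=> `[if b then 0 else - M, M]%classic)) => _.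
  exact: segment_compact.
apply/seteqP; split=> x /=.
  move=> [xD xM] i; rewrite in_itv/=.
  have := le_trans (ler_coord_norm x i) xM; rewrite ler_norml => /andP[x1 x2].
  by rewrite x2 andbT; case: ifPn => // /(xD i).
move=> xM; split=> [i bT|].
  by have := xM i; rewrite in_itv/= bT => /andP[].
apply: ler_norm_coord => // i; have := xM i; rewrite in_itv/= => /andP[x1 x2].
rewrite ler_norml x2 andbT; apply: le_trans x1.
by case: ifP => _ //; rewrite oppr_le0.
Qed.

Lemma continuous_cone_bounded h (M : R) : {within closed_cone, continuous h} ->
  exists2 B, 0 <= B & forall x, closed_cone x -> `|x| <= M -> `|h x| <= B.
Proof.
move=> ch; pose A : set 'rV[R]_d := [set x | closed_cone x /\ `|x| <= M].
have chA : {within A, continuous h}.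
  by apply: continuous_subspaceW ch => x [].
have /compact_bounded[B [_ hB]] := continuous_compact chA (@compact_cone_ball M).
exists (`|B| + 1) => [|x xD xM]; first by rewrite addr_ge0.
apply: (hB (`|B| + 1)); last by exists x.
by rewrite (le_lt_trans (ler_norm B))// ltrDl.
Qed.

(** Polynomial growth only controls g far from the origin. Near the origin the
    bound comes from compactness, through the continuous extension h of g to the
    closed cone. *)
Lemma poly_growth_bound g :
  poly_growth_on open_cone g ->
  (exists2 h, {within closed_cone, continuous h} &
    forall x, open_cone x -> h x = g x) ->
  exists K k, 0 <= K /\ forall x, open_cone x -> `|g x| <= K * (1 + `|x|) ^+ k.
Proof.
move=> [k [C [M gM]]] [h ch hg].
have [B B0 hB] := continuous_cone_bounded M ch.
exists (B + `|C|), k; split=> [|x xU]; first by rewrite addr_ge0.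
have [Mx|/ltW xM] := leP M `|x|.
  apply: le_trans (gM x xU Mx) _.
  apply: (@le_trans _ _ (`|C| * `|x| ^+ k)).
    by rewrite ler_wpM2r ?exprn_ge0// ler_norm.
  by rewrite ler_pM ?exprn_ge0// ?lerDr// lerXn2r ?nnegrE ?addr_ge0// lerDr.
rewrite -hg//; apply: le_trans (hB x (open_cone_closed xU) xM) _.
rewrite -[leLHS]mulr1 ler_pM ?lerDl//.
by rewrite exprn_ege1// lerDl.
Qed.

End cones.

Arguments closed_cone {R} b {d}.
Arguments open_cone {R} b {d}.

(** * Increments along a ray *)

Section increments.
Context (R : realType) (d : nat).
Implicit Types (x y : 'rV[R]_d) (V : 'rV[R]_d -> R).

(** The mean value theorem on the segment from y to y + h e_i; since h may be
    negative, its parameter ranges between min 0 h and max 0 h. *)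
Lemma partial_increment V y (i : 'I_d) (h M : R) :
  (forall t, Num.min 0 h <= t <= Num.max 0 h ->
    derivable V (y + t *: delta_mx ord0 i) (delta_mx ord0 i) /\
    `|partial i V (y + t *: delta_mx ord0 i)| <= M) ->
  `|V (y + h *: delta_mx ord0 i) - V y| <= `|h| * M.
Proof.
set e := delta_mx ord0 i => hV.
pose phi t := V (y + t *: e); pose dphi t := partial i V (y + t *: e).
set a := Num.min 0 h in hV *; set b := Num.max 0 h in hV *.
have ab : a <= b by rewrite /a /b; case: (leP 0 h) => // /ltW.
have phi_is t : a <= t <= b -> is_derive t 1 phi (dphi t).
  move=> /hV[dV _].
  have E : (fun u : R => u^-1 *: (phi (u *: 1 + t) - phi t)) =
           (fun u : R => u^-1 *: (V (u *: e + (y + t *: e)) - V (y + t *: e))).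
    apply/funext => u; rewrite /phi; congr (_ *: (V _ - _)).
    by rewrite addrCA -scalerDl [u *: 1]mulr1.
  apply: DeriveDef; last by rewrite /derive /dphi /partial /derive; congr lim; rewrite E.
  by move: dV; rewrite /derivable E.
have cphi : {within `[a, b], continuous phi}.
  apply: derivable_within_continuous => t; rewrite in_itv/= => tab.
  by case: (phi_is t tab).
have [c cab phiE] : exists2 c, c \in `[a, b] &
    phi b - phi a = dphi c * (b - a).
  apply: MVT_segment => // t.
  by rewrite in_itv/= => /andP[/ltW ta /ltW tb]; apply/phi_is/andP.
have {phiE} E : `|phi h - phi 0| = `|dphi c| * `|h|.
  move: phiE; rewrite /a /b; case: (leP 0 h) => h0 /=.
    by rewrite subr0 => ->; rewrite normrM.
  by rewrite sub0r distrC => ->; rewrite normrM normrN.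
rewrite mulrC; have -> : V y = phi 0 by rewrite /phi scale0r addr0.
rewrite -/(phi h) E ler_wpM2r//.
by have [] := hV c; [move: cab; rewrite in_itv|].
Qed.

Lemma between_scale (c u t : R) : 0 < c <= 1 ->
  Num.min 0 ((c - 1) * u) <= t <= Num.max 0 ((c - 1) * u) ->
  `|u + t| <= `|u| /\ (0 < u -> 0 < u + t).
Proof.
move=> /andP[c0 c1]; have [u0|u0] := leP 0 u.
  have cu : 0 <= (1 - c) * u by rewrite mulr_ge0// subr_ge0.
  have cu' : 0 <= c * u by rewrite mulr_ge0// ltW.
  rewrite min_r ?max_l; [|lra|lra] => /andP[t1 t2].
  split=> [|u1]; first by rewrite !ger0_norm; lra.
  have : 0 < c * u by exact: mulr_gt0.
  lra.
have cu : 0 <= (1 - c) * - u by rewrite mulr_ge0 ?subr_ge0// oppr_ge0 ltW.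
have cu' : 0 <= c * - u by rewrite mulr_ge0 ?oppr_ge0// ltW.
rewrite min_l ?max_r; [|lra|lra] => /andP[t1 t2].
by split=> [|u1]; [rewrite !ler0_norm; lra|lra].
Qed.

(** The point x is moved to c x one coordinate at a time, and each move is
    controlled by one partial derivative. The points passed on the way stay in the
    open cone and have norm at most the norm of x, because each coordinate only
    shrinks and keeps its sign. *)
Lemma cone_scale_increment (b : bool) V x (c M : R) : 0 < c <= 1 ->
  open_cone b x ->
  (forall y i, open_cone b y -> `|y| <= `|x| ->
    derivable V y (delta_mx ord0 i) /\ `|partial i V y| <= M) ->
  `|V (c *: x) - V x| <= (1 - c) * `|x| * (d%:R * M).
Proof.
move=> /andP[c0 c1] xU hV.
pose w k : 'rV[R]_d := \row_i (if (i < k)%N then c * x ord0 i else x ord0 i).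
have w0 : w 0%N = x by apply/rowP => i; rewrite mxE.
have wd : w d = c *: x by apply/rowP => i; rewrite !mxE ltn_ord.
have wS (k : 'I_d) : w k.+1 = w k + ((c - 1) * x ord0 k) *: delta_mx ord0 k.
  apply/rowP => j; rewrite !mxE eqxx/= ltnS leq_eqVlt.
  have [->|jk] := eqVneq j k; first by rewrite eqxx ltnn mulr1; ring.
  by rewrite (negbTE (jk : j != k :> nat)) mulr0 addr0.
have step (k : 'I_d) : `|V (w k.+1) - V (w k)| <= (1 - c) * `|x| * M.
  have [||dV0 dVM] := hV x k => //.
  have M0 : 0 <= M by apply: le_trans dVM.
  rewrite wS; apply: le_trans (partial_increment (M := M) _) _; last first.
    rewrite normrM ler_wpM2r// distrC [X in X * _]ger0_norm ?subr_ge0//.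
    by rewrite ler_wpM2l ?subr_ge0// ler_coord_norm.
  move=> t tab; apply: hV => [j bT|].
    rewrite !mxE eqxx/=; have xj := xU j bT.
    have [->|jk] := eqVneq j k.
      by rewrite ltnn mulr1; apply: (between_scale _ tab).2; rewrite ?c0 ?xU.
    by rewrite mulr0 addr0; case: ifP => _ //; exact: mulr_gt0.
  apply: ler_norm_coord => // j; apply: le_trans (ler_coord_norm x j).
  rewrite !mxE eqxx/=; have [->|jk] := eqVneq j k.
    by rewrite ltnn mulr1; apply: (between_scale _ tab).1; rewrite c0.
  rewrite mulr0 addr0; case: ifP => _ //.
  by rewrite normrM ler_piMl// gtr0_norm.
rewrite -wd -{1}w0 -(@telescope_sumr _ 0 d (fun k => V (w k)))// big_mkord.
apply: le_trans (ler_norm_sum _ _ _) _.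
apply: le_trans (ler_sum _ (fun k _ => step k)) _.
rewrite sumr_const card_ord -[leLHS]mulr_natl [leLHS](_ : _ = (1 - c) * `|x| * (d%:R * M))//.
by ring.
Qed.

End increments.

(** * Potentials and their densities *)

Section regular_potential.
Context (R : realType) (d : nat).
Implicit Types (b : bool) (x : 'rV[R]_d) (V : 'rV[R]_d -> R).

(** The common features of the potentials of the two classes that enter the
    estimate of the Hellinger distance. *)
Definition regular_potential b V : Prop :=
  [/\ {within closed_cone b, continuous V},
      forall x i, open_cone b x -> derivable V x (delta_mx ord0 i),
      exists K k, 0 <= K /\ forall x i, open_cone b x ->
        `|partial i V x| <= K * (1 + `|x|) ^+ k
    & exp_superpoly_on (closed_cone b) V].

Definition cone_density b V x : R :=
  if x \in closed_cone b then expR (- V x) else 0.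

(** The sums over i of the constants and of the exponents serve for all i. *)
Lemma partial_growth_uniform b V :
  (forall i, exists K k, 0 <= K /\ forall x, open_cone b x ->
    `|partial i V x| <= K * (1 + `|x|) ^+ k) ->
  exists K k, 0 <= K /\ forall x i, open_cone b x ->
    `|partial i V x| <= K * (1 + `|x|) ^+ k.
Proof.
move=> H.
have {H} : forall i, exists Kk : R * nat, 0 <= Kk.1 /\ forall x, open_cone b x ->
    `|partial i V x| <= Kk.1 * (1 + `|x|) ^+ Kk.2.
  by move=> i; have [K [k Hk]] := H i; exists (K, k).
move=> /choice[f fP].
exists (\sum_i (f i).1), (\sum_i (f i).2)%N; split.
  by apply: sumr_ge0 => i _; have [] := fP i.
move=> x i xU; have [K0 /(_ x xU) H] := fP i; apply: le_trans H _.
rewrite ler_pM ?exprn_ge0 ?addr_ge0//.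
  by rewrite (bigD1 i)//= lerDl; apply: sumr_ge0 => j _; have [] := fP j.
by apply: ler_weXn2l; [rewrite lerDl | rewrite (bigD1 i)//= leq_addr].
Qed.

Lemma class_regular_potential (p : 'rV[R]_d -> R) :
  classP p \/ classPplus p ->
  probability_density p /\
  exists b V, regular_potential b V /\ p = cone_density b V.
Proof.
case=> -[pp [V]].
- move=> [pE sV gV eV]; split=> //; exists false, V.
  have cE : closed_cone false = [set: 'rV[R]_d].
    by apply/seteqP; split=> // x _ i.
  split; last first.
    by rewrite pE; apply/funext => x; rewrite /cone_density cE in_setT.
  split; rewrite ?cE//.
  + by apply: continuous_subspaceT => x; exact: (sV [::] x I).1.
  + by move=> x i _; exact: (sV [::] x I).2.
  + apply: partial_growth_uniform => i; apply: poly_growth_bound.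
      by have [k [C [M H]]] := gV [:: i]; exists k, C, M => x _; exact: H.
    exists (iter_partial [:: i] V) => //; rewrite cE.
    by apply: continuous_subspaceT => x; exact: (sV [:: i] x I).1.
- move=> [pE sV cV gV eV]; split=> //; exists true, V.
  have cE : closed_cone true = @nneg_orthant R d.
    by apply/seteqP; split=> x xD i; [exact: xD | move=> _; exact: xD].
  have oE : open_cone true = @pos_orthant R d.
    by apply/seteqP; split=> x xD i; [exact: xD | move=> _; exact: xD].
  split; last by rewrite pE; apply/funext => x; rewrite /cone_density cE.
  split; rewrite ?cE ?oE//.
  + by move=> x i xU; exact: (sV [::] x xU).2.
  + rewrite -oE; apply: partial_growth_uniform => i; apply: poly_growth_bound.
      by rewrite oE; exact: (gV [:: i]).1.
    have [h [ch hE]] := (gV [:: i]).2; exists h; first by rewrite cE.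
    by rewrite oE.
Qed.

(** At infinity this is the superpolynomial growth of the exponential of V; in a
    ball V is bounded, by compactness. *)
Lemma regular_potential_decay b V (N : nat) : regular_potential b V ->
  exists2 B, 0 <= B & forall x, closed_cone b x ->
    expR (- V x) * (1 + `|x|) ^+ N <= B.
Proof.
move=> [cV _ _ /(_ N (2 ^+ N))[M eV]].
pose M1 := Num.max M 1.
have [B B0 VB] := continuous_cone_bounded M1 cV.
exists (1 + expR B * (1 + `|M1|) ^+ N) => [|x xD].
  by rewrite addr_ge0// mulr_ge0 ?expR_ge0// exprn_ge0// addr_ge0.
have [Mx|/ltW xM] := leP M1 `|x|.
  have [Mx1 Mx2] : M <= `|x| /\ 1 <= `|x|.
    by move: Mx; rewrite ge_max => /andP.
  apply: (@le_trans _ _ 1); last first.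
    by rewrite lerDl mulr_ge0 ?expR_ge0// exprn_ge0// addr_ge0.
  rewrite expRN mulrC ler_pdivrMr ?expR_gt0// mul1r.
  apply: le_trans (eV x xD Mx1); rewrite -exprMn lerXn2r ?nnegrE ?addr_ge0//.
  by lra.
apply: (@le_trans _ _ (expR B * (1 + `|M1|) ^+ N)); last by rewrite lerDr.
rewrite ler_pM ?expR_ge0 ?exprn_ge0 ?addr_ge0//.
  rewrite ler_expR; have := VB x xD xM; rewrite ler_norml => /andP[]; lra.
rewrite lerXn2r ?nnegrE ?addr_ge0// lerD2l.
by apply: le_trans xM _; rewrite ler_norm.
Qed.

Lemma measurable_cone_density b V : regular_potential b V ->
  measurable_fun setT (cone_density b V).
Proof.
move=> [cV _ _ _].
have mD := @measurable_closed_cone R b d.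
rewrite (_ : cone_density b V = (fun x => expR (- V x)) \_ (closed_cone b)).
  apply: (iffLR (measurable_restrictT (fun x => expR (- V x)) mD)).
  apply: (measurableT_comp (@measurable_expR R)).
  apply: measurable_funN.
  exact: continuous_within_measurable.
by apply/funext => x; rewrite patchE.
Qed.

Lemma cone_density_ge0 b V x : 0 <= cone_density b V x.
Proof. by rewrite /cone_density; case: ifP => // _; exact: expR_ge0. Qed.

End regular_potential.

(** * Hellinger distance between a density and its rescaling *)

Section hellinger.
Context (R : realType) (d : nat).
Implicit Types (b : bool) (x : 'rV[R]_d) (V : 'rV[R]_d -> R).

(** If v <= u then expR u - expR v <= (u - v) * expR u, because
    1 + (v - u) <= expR (v - u). *)
Lemma expR_sub_sqr (u v : R) :
  (expR u - expR v) ^+ 2 <= (u - v) ^+ 2 * (expR u ^+ 2 + expR v ^+ 2).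
Proof.
wlog uv : u v / v <= u.
  move=> H; have [/H//|/ltW/H] := leP v u.
  by rewrite -sqrrN opprB -[(v - u) ^+ 2]sqrrN opprB [expR v ^+ 2 + _]addrC.
have h : expR u - expR v <= (u - v) * expR u.
  have := expR_ge1Dx (v - u); rewrite expRD expRN.
  move=> /(ler_wpM2r (expR_ge0 u)); rewrite mulfVK ?gt_eqF ?expR_gt0//; lra.
have h0 : 0 <= expR u - expR v by rewrite subr_ge0 ler_expR.
apply: (@le_trans _ _ (((u - v) * expR u) ^+ 2)).
  by rewrite lerXn2r// nnegrE mulr_ge0 ?subr_ge0 ?expR_ge0.
by rewrite exprMn ler_wpM2l ?sqr_ge0// lerDl sqr_ge0.
Qed.

(** If X has density p then expR s *: X has density q, where
    q x = c ^+ d * p (c *: x) with c = expR (- s). On the cone this is the square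
    root of q / p; outside of it both densities vanish. *)
Definition scale_ratio b V (s : R) x : R :=
  if x \in closed_cone b then
    expR ((V x - (V (expR (- s) *: x) + d%:R * s)) / 2) else 0.

Lemma scale_ratio_ge0 b V s x : 0 <= scale_ratio b V s x.
Proof. by rewrite /scale_ratio; case: ifP => // _; exact: expR_ge0. Qed.

Lemma scale_ratio_sqr b V s x :
  scale_ratio b V s x ^+ 2 * cone_density b V x =
  expR (- s) ^+ d * cone_density b V (expR (- s) *: x).
Proof.
rewrite /scale_ratio /cone_density.
have -> : (expR (- s) *: x \in closed_cone b) = (x \in closed_cone b).
  by apply/idP/idP; rewrite !inE => /closed_coneZ; apply; exact: expR_gt0.
case: ifP => _; last by rewrite !mulr0.
rewrite -!expRM_natl -!expRD; congr expR; by field.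
Qed.

Lemma scale_ratio_diff b V s x : x \in closed_cone b ->
  cone_density b V x * (1 - scale_ratio b V s x) ^+ 2 =
  (expR (- V x / 2) - expR (- (V (expR (- s) *: x) + d%:R * s) / 2)) ^+ 2.
Proof.
move=> xD; rewrite /scale_ratio /cone_density xD.
have -> : expR (- V x) = expR (- V x / 2) ^+ 2.
  by rewrite -expRM_natl; congr expR; by field.
rewrite -exprMn mulrBr mulr1 -expRD; congr ((_ - expR _) ^+ 2); by field.
Qed.

Lemma measurable_scale_ratio b V s : regular_potential b V ->
  measurable_fun setT (scale_ratio b V s).
Proof.
move=> [cV _ _ _].
have mD := @measurable_closed_cone R b d.
have mV : measurable_fun setT (V \_ (closed_cone b)).
  apply: (iffLR (measurable_restrictT V mD)).
  exact: continuous_within_measurable.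
pose W := V \_ (closed_cone b).
rewrite (_ : scale_ratio b V s = (fun x => expR
  ((W x - (W (expR (- s) *: x) + d%:R * s)) / 2)) \_ (closed_cone b)).
  apply: (iffLR (measurable_restrictT _ mD)).
  apply: (measurableT_comp (@measurable_expR R)).
  apply: measurable_funM => //; apply: measurable_funB.
    exact: measurable_funTS.
  apply: measurable_funD => //; apply: measurable_funTS.
  exact: (measurableT_comp mV (@measurable_rV_scale R d _)).
apply/funext => x; rewrite patchE /scale_ratio; case: ifPn => // xD.
rewrite /W !patchE xD ifT// inE; apply/closed_coneZ; first exact: expR_gt0.
by rewrite inE in xD.
Qed.

Lemma prod_oneDsqr_le x :
  \prod_(i < d) (1 + x ord0 i ^+ 2) <= (1 + `|x|) ^+ (2 * d).
Proof.
rewrite exprM -[X in _ <= _ ^+ X]card_ord -prodr_const.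
apply: ler_prod => i _; rewrite addr_ge0 ?sqr_ge0//=.
have := ler_coord_norm x i; rewrite -[x ord0 i ^+ 2]real_normK ?num_real//.
have := normr_ge0 (x ord0 i); nra.
Qed.

(** With c = expR (- s), u = V x and v = V (c *: x) + d s, the left-hand side is
    the square of expR (- u / 2) - expR (- v / 2), hence at most
    (u - v)^2 / 4 times expR (- u) + expR (- v). The first factor is at most s^2
    times a polynomial in the norm of x, since 1 - c <= s; the second one decays
    faster than any polynomial, because the norms of x and c *: x differ at most
    by the factor expR 1. *)
Lemma scale_ratio_bound b V : regular_potential b V ->
  exists2 C, 0 <= C & forall s x, 0 <= s <= 1 -> open_cone b x ->
    cone_density b V x * (1 - scale_ratio b V s x) ^+ 2 <=
    s ^+ 2 * C * \prod_(i < d) (1 + x ord0 i ^+ 2)^-1.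
Proof.
move=> rV; have [cV dV [K [k [K0 VK]]] eV] := rV.
(* The factor (1 + |x|)^(2 (k + 1)) absorbs the square of the increment of V,
   and (1 + |x|)^(2 d) the inverse of the product on the right-hand side. *)
pose N := (2 * k.+1 + 2 * d)%N.
have [B B0 VB] := regular_potential_decay N rV.
pose E := expR 1 : R; have E1 : 1 <= E by have := @expR_ge1Dx R 1; rewrite /E; lra.
pose Q := d%:R * (K + 1); have Q0 : 0 <= Q by rewrite mulr_ge0// addr_ge0.
exists (Q ^+ 2 / 4 * (B * (1 + E ^+ N))).
  by rewrite mulr_ge0 ?divr_ge0 ?sqr_ge0// mulr_ge0// addr_ge0// exprn_ge0//; lra.
move=> s x /andP[s0 s1] xU.
have xD : closed_cone b x by exact: open_cone_closed.
set c := expR (- s); have c0 : 0 < c by exact: expR_gt0.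
have c1 : c <= 1 by rewrite -expR0 ler_expR oppr_le0.
have cs : 1 - c <= s by have := @expR_ge1Dx R (- s); rewrite -/c; lra.
have cxD : closed_cone b (c *: x) by exact/closed_coneZ.
rewrite scale_ratio_diff ?inE// -/c.
set u := V x; set v := V (c *: x) + d%:R * s.
set X := 1 + `|x|; have X1 : 1 <= X by rewrite /X lerDl.
have X0 : 0 < X by lra.
have uv : `|u - v| <= s * Q * X ^+ k.+1.
  have h1 : `|V (c *: x) - V x| <= (1 - c) * `|x| * (d%:R * (K * X ^+ k)).
    apply: (@cone_scale_increment _ _ b) => //; first by rewrite c0.
    move=> y i yU yx; split; first exact: dV.
    apply: le_trans (VK y i yU) _; rewrite ler_wpM2l// lerXn2r ?nnegrE ?addr_ge0//.
    by rewrite lerD2l.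
  have Xk : 1 <= X ^+ k by rewrite exprn_ege1.
  have h2 : (1 - c) * `|x| * (d%:R * (K * X ^+ k)) <= s * (d%:R * K * X ^+ k.+1).
    rewrite exprS [leLHS](_ : _ = (1 - c) * `|x| * (d%:R * K * X ^+ k)); last by ring.
    rewrite [leRHS](_ : _ = s * X * (d%:R * K * X ^+ k)); last by ring.
    apply: ler_wpM2r; first by rewrite !mulr_ge0//; lra.
    by rewrite ler_pM// ?subr_ge0// /X lerDr.
  have h3 : d%:R * s <= s * (d%:R * X ^+ k.+1).
    by rewrite mulrC ler_wpM2l// ler_peMr// exprn_ege1.
  have -> : s * Q * X ^+ k.+1 = s * (d%:R * K * X ^+ k.+1) + s * (d%:R * X ^+ k.+1).
    by rewrite /Q; ring.
  rewrite /u /v opprD addrA (le_trans (ler_normB _ _))// lerD//.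
    by rewrite distrC (le_trans h1).
  by rewrite ger0_norm// mulr_ge0.
have e1 : expR (- u) * X ^+ N <= B by exact: VB.
have e2 : expR (- v) * X ^+ N <= B * E ^+ N.
  have h1 : expR (- v) <= expR (- V (c *: x)).
    by rewrite ler_expR lerN2 /v lerDl mulr_ge0.
  have h2 : X <= E * (1 + `|c *: x|).
    rewrite normrZ gtr0_norm// mulrDr mulr1 mulrA /X lerD// ler_peMl//.
    by rewrite /E /c -expRD -[leLHS]expR0 ler_expR subr_ge0.
  have h3 : X ^+ N <= E ^+ N * (1 + `|c *: x|) ^+ N.
    by rewrite -exprMn lerXn2r ?nnegrE// ?mulr_ge0 ?addr_ge0//; lra.
  apply: (@le_trans _ _ (expR (- V (c *: x)) * (E ^+ N * (1 + `|c *: x|) ^+ N))).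
    by rewrite ler_pM ?expR_ge0// exprn_ge0//; lra.
  rewrite mulrCA mulrC; apply: ler_wpM2r; first by rewrite exprn_ge0//; lra.
  exact: VB.
have XN : X ^+ N = (X ^+ k.+1) ^+ 2 * X ^+ (2 * d).
  by rewrite /N exprD mulnC exprM.
apply: (@le_trans _ _ (s ^+ 2 * (Q ^+ 2 / 4 * (B * (1 + E ^+ N))) * (X ^+ (2 * d))^-1)).
  rewrite ler_pdivlMr ?exprn_gt0//.
  have h : (expR (- u / 2) - expR (- v / 2)) ^+ 2 <=
      ((u - v) / 2) ^+ 2 * (expR (- u) + expR (- v)).
    have := expR_sub_sqr (- u / 2) (- v / 2); rewrite -!expRM_natl.
    have -> : 2 * (- u / 2) = - u by field.
    have -> : 2 * (- v / 2) = - v by field.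
    have -> : - u / 2 - - v / 2 = - ((u - v) / 2) by ring.
    by rewrite sqrrN.
  apply: le_trans (ler_wpM2r _ h) _; first by rewrite exprn_ge0// ltW.
  have h2 : (u - v) ^+ 2 <= (s * Q) ^+ 2 * (X ^+ k.+1) ^+ 2.
    rewrite -exprMn -[leLHS]real_normK ?num_real// lerXn2r ?nnegrE//.
    by rewrite (le_trans _ uv).
  have h3 : (expR (- u) + expR (- v)) * X ^+ N <= B * (1 + E ^+ N) by lra.
  have h4 : 0 <= (expR (- u) + expR (- v)) * X ^+ (2 * d).
    by rewrite mulr_ge0 ?addr_ge0 ?expR_ge0// exprn_ge0// ltW.
  apply: (@le_trans _ _ ((s * Q) ^+ 2 / 4 * ((expR (- u) + expR (- v)) * X ^+ N))).
    rewrite XN; nra.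
  rewrite [leRHS](_ : _ = (s * Q) ^+ 2 / 4 * (B * (1 + E ^+ N))); last by ring.
  by rewrite ler_wpM2l// divr_ge0// sqr_ge0.
apply: ler_wpM2l.
  rewrite mulr_ge0 ?sqr_ge0// mulr_ge0 ?divr_ge0 ?sqr_ge0//.
  by rewrite mulr_ge0// addr_ge0// exprn_ge0//; lra.
rewrite prodfV lef_pV2 ?posrE ?exprn_gt0//; first exact: prod_oneDsqr_le.
by apply: prodr_gt0 => i _; rewrite ltr_pwDl// sqr_ge0.
Qed.

End hellinger.

Section affinity.
Context (R : realType) (d : nat).
Implicit Types (b : bool) (x : 'rV[R]_d) (V : 'rV[R]_d -> R).
Let mu := lebesgue_rV R d.

Lemma ae_open_cone b :
  {ae mu, forall x, closed_cone b x -> open_cone b x}.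
Proof.
have H (i : 'I_d) : mu.-negligible [set x : 'rV[R]_d | x ord0 i = 0].
  apply/negligibleP; last exact: lebesgue_rV_hyperplane.
  rewrite -[X in measurable X]setTI.
  exact: (@measurable_rV_coord R d i measurableT [set 0]).
have : mu.-negligible
    (\big[setU/set0]_(i < d) [set x : 'rV[R]_d | x ord0 i = 0]).
  elim/big_ind: _ => //; [exact: negligible_set0|exact: negligibleU].
apply: negligibleS => x /= /not_implyP[xD /existsNP[i /not_implyP[bT xi]]].
rewrite -bigcup_seq; exists i => /=; first by rewrite mem_index_enum.
apply/eqP; rewrite eq_le (xD i bT) andbT leNgt; exact/negP.
Qed.

(** Integrating p (1 - z)^2 = p - 2 z p + z^2 p, where p and z^2 p are probability
    densities, expresses the affinity h through the squared Hellinger distance: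
    the latter is 2 - 2 h. It is of order s^2 by the pointwise bound, which holds
    outside the null set of the points of the closed cone on its boundary. *)
Lemma scale_ratio_affinity b V : regular_potential b V ->
  (\int[mu]_x (cone_density b V x)%:E = 1)%E ->
  exists2 C, 0 <= C & forall s, 0 <= s <= 1 ->
    exists2 h, 1 - C * s ^+ 2 <= h &
      (\int[mu]_x (scale_ratio b V s x * cone_density b V x)%:E = h%:E)%E.
Proof.
move=> rV p1; have [C0 C00 hC] := scale_ratio_bound rV.
exists (C0 * pi ^+ d / 2).
  by rewrite divr_ge0// mulr_ge0// exprn_ge0// pi_ge0.
move=> s s01.
set p := cone_density b V in p1 hC *; set z := scale_ratio b V s.
have mp : measurable_fun setT p by exact: measurable_cone_density.
have mz : measurable_fun setT z by exact: measurable_scale_ratio.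
have p0 x : 0 <= p x by exact: cone_density_ge0.
have z0 x : 0 <= z x by exact: scale_ratio_ge0.
have q1 : (\int[mu]_x (z x ^+ 2 * p x)%:E = 1)%E.
  rewrite -p1 (@ge0_integral_rV_scale R d (expR (- s)) (fun x => (p x)%:E)
    (expR_gt0 _)); last 2 first.
  - exact/measurable_EFinP.
  - by move=> x; rewrite lee_fin.
  have mpc : measurable_fun setT (fun x => p (expR (- s) *: x)).
    exact: (measurableT_comp mp (@measurable_rV_scale R d _)).
  rewrite -ge0_integralZl_EFin ?exprn_ge0 ?expR_ge0//; last 2 first.
  - by move=> x _; rewrite lee_fin.
  - exact/measurable_EFinP.
  by apply: eq_integral => x _; rewrite scale_ratio_sqr EFinM.
pose D x := p x * (1 - z x) ^+ 2.
have D0 x : 0 <= D x by rewrite mulr_ge0// sqr_ge0.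
have mD : measurable_fun setT D.
  apply: measurable_funM => //; apply: measurable_funX.
  exact: measurable_funB.
have mzp : measurable_fun setT (fun x => z x * p x) by exact: measurable_funM.
have mz2p : measurable_fun setT (fun x => z x ^+ 2 * p x).
  by apply: measurable_funM => //; exact: measurable_funX.
have DI : (\int[mu]_x (D x)%:E <= (s ^+ 2 * C0 * pi ^+ d)%:E)%E.
  pose w (t : R) := (1 + t ^+ 2)^-1.
  have w0 t : 0 <= w t by rewrite invr_ge0 addr_ge0// sqr_ge0.
  have mw : measurable_fun setT w.
    by apply: continuous_measurable_fun; exact: continuous_oneDsqrV.
  have mpw : measurable_fun setT
      (fun x : 'rV[R]_d => \prod_(i < d) w (x ord0 i)).
    apply: measurable_prod => i _.
    by apply: (measurableT_comp mw); exact: measurable_rV_coord.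
  have sC : 0 <= s ^+ 2 * C0 by rewrite mulr_ge0// sqr_ge0.
  rewrite EFinM -(integral_rV_prod d mw w0 (@integral_inv_oneDsqr R)).
  rewrite -ge0_integralZl_EFin//; last 2 first.
  - by move=> x _; rewrite lee_fin prodr_ge0.
  - exact/measurable_EFinP.
  apply: ae_ge0_le_integral => //.
  - by move=> x _; rewrite lee_fin.
  - exact/measurable_EFinP.
  - by move=> x _; rewrite -EFinM lee_fin mulr_ge0// prodr_ge0.
  - by apply/measurable_EFinP; exact: measurable_funM.
  apply: filterS (ae_open_cone b) => x Dx _.
  rewrite -EFinM lee_fin.
  have [xD|xD] := boolP (x \in closed_cone b).
    by apply: hC => //; apply: Dx; rewrite inE in xD.
  by rewrite /D /p /cone_density (negbTE xD) mul0r mulr_ge0// prodr_ge0.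
have key : (\int[mu]_x (D x)%:E + 2%:E * \int[mu]_x (z x * p x)%:E = 2%:E)%E.
  rewrite -ge0_integralZl_EFin//; last 2 first.
  - by move=> x _; rewrite lee_fin mulr_ge0.
  - exact/measurable_EFinP.
  rewrite -ge0_integralD//; last 4 first.
  - by move=> x _; rewrite lee_fin.
  - exact/measurable_EFinP.
  - by move=> x _; rewrite -EFinM lee_fin mulr_ge0// mulr_ge0.
  - by apply/measurable_EFinP; exact: measurable_funM.
  transitivity (\int[mu]_x ((p x)%:E + (z x ^+ 2 * p x)%:E))%E.
    by apply: eq_integral => x _; rewrite -EFinM -!EFinD; congr EFin; rewrite /D; ring.
  rewrite ge0_integralD//; last 4 first.
  - by move=> x _; rewrite lee_fin.
  - exact/measurable_EFinP.
  - by move=> x _; rewrite lee_fin mulr_ge0// sqr_ge0.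
  - exact/measurable_EFinP.
  by rewrite p1 q1 -EFinD.
have I0 : (0 <= \int[mu]_x (D x)%:E)%E by apply: integral_ge0 => x _; rewrite lee_fin.
have J0 : (0 <= \int[mu]_x (z x * p x)%:E)%E.
  by apply: integral_ge0 => x _; rewrite lee_fin mulr_ge0.
move: key DI I0 J0.
case: (\int[mu]_x (D x)%:E)%E => [I| |] //;
  case: (\int[mu]_x (z x * p x)%:E)%E => [J| |] //.
- rewrite -EFinM -EFinD => -[key]; rewrite !lee_fin => DI _ _.
  exists J => //; lra.
- by rewrite mulry gtr0_sg// mul1e.
Qed.

End affinity.

(** * Comparison of probabilities *)

Lemma bernoulli_sub (R : realType) (y : R) n :
  0 <= y <= 1 -> 1 - n%:R * y <= (1 - y) ^+ n.
Proof.
move=> /andP[y0 y1]; elim: n => [|n IH]; first by rewrite mul0r subr0 expr0.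
have h : 0 <= (n%:R : R) * y ^+ 2 by rewrite mulr_ge0// sqr_ge0.
rewrite exprS; apply: (@le_trans _ _ ((1 - y) * (1 - n%:R * y))).
  by rewrite -natr1; nra.
by rewrite ler_wpM2l// subr_ge0.
Qed.

Section transport.
Context (R : realType) (disp : measure_display) (T : measurableType disp)
  (P : probability T R).

(** Integrate (a + b)^2 <= (1 + eta) a^2 + (1 + 1 / eta) b^2 over A for a = Z and
    b = 1 - Z. The last term is at most (1 + 1 / eta) E (1 - Z)^2, and expanding the
    square gives E (1 - Z)^2 = 2 - 2 h. When Z ^+ 2 is the density of another
    probability, this bounds the probability of A by that other one. *)
Lemma probability_transport (Z : T -> R) (h eta : R) (A : set T) :
  measurable_fun setT Z -> (forall w, 0 <= Z w) ->
  (\int[P]_w (Z w)%:E = h%:E)%E -> (\int[P]_w (Z w ^+ 2)%:E = 1)%E ->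
  0 < eta -> measurable A ->
  (P A <= (1 + eta)%:E * \int[P]_w ((\1_A w)%:E * (Z w ^+ 2)%:E) +
          ((1 + eta^-1) * (2 - 2 * h))%:E)%E.
Proof.
move=> mZ Z0 EZ EZ2 eta0 mA.
have mD : measurable_fun setT (fun w => (1 - Z w) ^+ 2).
  by apply: measurable_funX; exact: measurable_funB.
have mZ2 : measurable_fun setT (fun w => Z w ^+ 2) by exact: measurable_funX.
have mAZ : measurable_fun setT (fun w => ((\1_A w)%:E * (Z w ^+ 2)%:E)%E).
  apply: emeasurable_funM; apply/measurable_EFinP => //.
have AZ0 w : (0 <= (\1_A w)%:E * (Z w ^+ 2)%:E)%E.
  by rewrite -EFinM lee_fin mulr_ge0// sqr_ge0.
have D1 : (\int[P]_w ((1 - Z w) ^+ 2)%:E = (2 - 2 * h)%:E)%E.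
  have key : (\int[P]_w ((1 - Z w) ^+ 2)%:E + (2 * h)%:E = 2%:E)%E.
    rewrite EFinM -EZ -ge0_integralZl_EFin//; last 2 first.
    - by move=> w _; rewrite lee_fin.
    - exact/measurable_EFinP.
    rewrite -ge0_integralD//; last 4 first.
    - by move=> w _; rewrite lee_fin sqr_ge0.
    - exact/measurable_EFinP.
    - by move=> w _; rewrite -EFinM lee_fin mulr_ge0.
    - by apply/measurable_EFinP; exact: measurable_funM.
    transitivity (\int[P]_w (1%:E + (Z w ^+ 2)%:E))%E.
      apply: eq_integral => w _; rewrite -EFinM -!EFinD; congr EFin; ring.
    rewrite ge0_integralD//; last 2 first.
    - by move=> w _; rewrite lee_fin sqr_ge0.
    - exact/measurable_EFinP.
    have -> : (\int[P]_w 1%:E = 1)%E.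
      rewrite (integral_cst P measurableT 1) mul1e; exact: probability_setT.
    by rewrite EZ2 -EFinD.
  by rewrite EFinB -key addeK.
have -> : P A = (\int[P]_w (\1_A w)%:E)%E by rewrite integral_indic// setIT.
rewrite EFinM -D1 -ge0_integralZl_EFin//; last first.
  by rewrite addr_ge0// ltW.
rewrite -ge0_integralZl_EFin//; last 3 first.
- by move=> w _; rewrite lee_fin sqr_ge0.
- exact/measurable_EFinP.
- by rewrite addr_ge0// invr_ge0 ltW.
rewrite -ge0_integralD; last 5 first.
- exact: measurableT.
- by move=> w _; rewrite mule_ge0// lee_fin addr_ge0// ltW.
- exact: measurable_funeM.
- by move=> w _; rewrite -EFinM lee_fin mulr_ge0 ?sqr_ge0// addr_ge0// invr_ge0 ltW.
- by apply: measurable_funeM; exact/measurable_EFinP.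
apply: ge0_le_integral.
- exact: measurableT.
- by move=> w _; rewrite lee_fin.
- exact/measurable_EFinP.
- apply: emeasurable_funD; first exact: measurable_funeM.
  by apply: measurable_funeM; exact/measurable_EFinP.
move=> w _; rewrite -!EFinM -EFinD lee_fin indicE.
have etaK : eta * eta^-1 = 1 by rewrite mulfV// gt_eqF.
have e0 : 0 < eta^-1 by rewrite invr_gt0.
case: (w \in A); rewrite /= ?mul0r ?mulr0 ?add0r; last first.
  by rewrite mulr_ge0 ?sqr_ge0// addr_ge0// ltW.
rewrite mul1r -subr_ge0.
have -> : (1 + eta) * Z w ^+ 2 + (1 + eta^-1) * (1 - Z w) ^+ 2 - 1 =
  eta^-1 * (eta * Z w - (1 - Z w)) ^+ 2.
  by field; rewrite gt_eqF.
by rewrite mulr_ge0 ?sqr_ge0// ltW.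
Qed.

End transport.

(** * Rescaling independent samples *)

Section sampling.
Context (R : realType) (d : nat) (disp : measure_display)
  (T : measurableType disp) (P : probability T R).
Context (X : nat -> {RV P >-> 'rV[R]_d}).
Let mu := lebesgue_rV R d.

Lemma integral_has_density k (p : 'rV[R]_d -> R) (g : 'rV[R]_d -> \bar R) :
  has_density (X k) p -> measurable_fun setT p -> (forall x, 0 <= p x) ->
  measurable_fun setT g -> (forall x, (0 <= g x)%E) ->
  (\int[P]_w g (X k w) = \int[mu]_x (g x * (p x)%:E))%E.
Proof.
move=> Xp mp p0 mg g0.
rewrite -(ge0_integral_density (nu := distribution P (X k)) mp p0 Xp mg g0).
by rewrite ge0_integral_distribution.
Qed.

(** Under the change of variable that replaces x by expR (- s) *: x the density
    p becomes z ^+ 2 * p. *)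
Lemma integral_scaled_sample k b V s (g : 'rV[R]_d -> \bar R) :
  regular_potential b V -> has_density (X k) (cone_density b V) ->
  measurable_fun setT g -> (forall x, (0 <= g x)%E) ->
  (\int[P]_w g (expR s *: X k w) =
   \int[P]_w (g (X k w) * (scale_ratio b V s (X k w) ^+ 2)%:E))%E.
Proof.
move=> rV Xp mg g0.
set p := cone_density b V in Xp *; set z := scale_ratio b V s.
have mp : measurable_fun setT p by exact: measurable_cone_density.
have mz : measurable_fun setT z by exact: measurable_scale_ratio.
have p0 x : 0 <= p x by exact: cone_density_ge0.
have mgs : measurable_fun setT (fun x : 'rV[R]_d => g (expR s *: x)).
  exact: (measurableT_comp mg (@measurable_rV_scale R d _)).
have mpc : measurable_fun setT (fun x : 'rV[R]_d => p (expR (- s) *: x)).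
  exact: (measurableT_comp mp (@measurable_rV_scale R d _)).
have mz2 : measurable_fun setT (fun x : 'rV[R]_d => (z x ^+ 2)%:E).
  by apply/measurable_EFinP; exact: measurable_funX.
rewrite (@integral_has_density k p (fun x => g (expR s *: x)))//.
rewrite (@integral_has_density k p (fun x => g x * (z x ^+ 2)%:E)%E)//; last 2 first.
- exact: emeasurable_funM.
- by move=> x; rewrite mule_ge0// lee_fin sqr_ge0.
rewrite (@ge0_integral_rV_scale R d (expR (- s))
  (fun x => g (expR s *: x) * (p x)%:E)%E (expR_gt0 _)); last 2 first.
- by apply: emeasurable_funM => //; exact/measurable_EFinP.
- by move=> x; rewrite mule_ge0// lee_fin.
rewrite -ge0_integralZl_EFin ?exprn_ge0 ?expR_ge0//; last 2 first.
- by move=> x _; rewrite mule_ge0// lee_fin.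
- apply: emeasurable_funM; last exact/measurable_EFinP.
  apply: (measurableT_comp mgs (@measurable_rV_scale R d _)).
apply: eq_integral => x _.
rewrite scalerA -expRD subrr expR0 scale1r muleCA -EFinM -scale_ratio_sqr.
by rewrite -muleA -EFinM.
Qed.

End sampling.

Lemma limn_einf_gt0 (R : realType) (u : nat -> \bar R) :
  (0 < limn_einf u)%E ->
  exists2 c : R, 0 < c & \forall n \near \oo, (c%:E <= u n)%E.
Proof.
rewrite limn_einf_lim => u0.
have [c c0 cu] : exists2 c : R, 0 < c & (c%:E < limn (einfs u))%E.
  case: (limn (einfs u)) u0 => [l| |]//; last by move=> _; exists 1; rewrite // ltry.
  by rewrite lte_fin => l0; exists (l / 2); rewrite ?lte_fin; lra.
exists c => //.
have : (c%:E < ereal_sup (range (einfs u)))%E.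
  by rewrite -(cvg_lim _ (cvg_einfs_sup (u := u))).
move=> /ereal_sup_gt[_ [n _ <-] cn]; exists n => // m /= nm.
by apply: le_trans (ltW cn) _; apply: ereal_inf_lbound; exists m.
Qed.

(** * Fluctuations of homogeneous statistics *)

(** An event that is likely for the sample is almost as likely for the rescaled
    sample as long as the affinity h ^+ n of the two laws is close to 1. *)
Lemma sample_transport (R : realType) (d : nat) (disp : measure_display)
    (T : measurableType disp) (P : probability T R)
    (X : nat -> {RV P >-> 'rV[R]_d}) b V (s h eta : R) n
    (A : set (n.-tuple 'rV[R]_d)) :
  independent_seq X -> regular_potential b V ->
  (forall k, has_density (X k) (cone_density b V)) ->
  (\int[lebesgue_rV R d]_x (scale_ratio b V s x * cone_density b V x)%:E
   = h%:E)%E ->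
  0 < eta -> measurable A ->
  (P (tail_tuple X 0 n @^-1` A) <=
   (1 + eta)%:E *
     P ((fun w => tuple_apply (fun x : 'rV[R]_d => expR s *: x)
                              (tail_tuple X 0 n w)) @^-1` A)
   + ((1 + eta^-1) * (2 - 2 * h ^+ n))%:E)%E.
Proof.
move=> indX rV Xp hE eta0 mA.
set z := scale_ratio b V s; set p := cone_density b V.
have mp : measurable_fun setT p by exact: measurable_cone_density.
have mz : measurable_fun setT z by exact: measurable_scale_ratio.
have p0 x : 0 <= p x by exact: cone_density_ge0.
have z0 x : 0 <= z x by exact: scale_ratio_ge0.
have mt : measurable_fun setT (tail_tuple X 0 n) by exact: measurable_tail_tuple.
have mS := @measurable_rV_scale R d (expR s).
have mSt : measurable_fun setT
    (fun w => tuple_apply (fun x : 'rV[R]_d => expR s *: x) (tail_tuple X 0 n w)).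
  exact: (measurableT_comp (@measurable_tuple_apply _ _ _ n mS) mt).
have change := integral_tail_change indX mz mS
  (fun k g mg g0 => @integral_scaled_sample R d _ T P X k b V s g rV (Xp k) mg g0).
pose Z w := tuple_prod z (tail_tuple X 0 n w).
have mZ : measurable_fun setT Z.
  exact: (measurableT_comp (@measurable_tuple_prod _ _ _ z n mz) mt).
have Z0 w : 0 <= Z w by exact: tuple_prod_ge0.
have EZ : (\int[P]_w (Z w)%:E = (h ^+ n)%:E)%E.
  apply: integral_tail_prod => // k.
  rewrite (@integral_has_density _ _ _ _ _ X k p (fun x => (z x)%:E))//.
  exact/measurable_EFinP.
have EZ2 : (\int[P]_w (Z w ^+ 2)%:E = 1)%E.
  transitivity (\int[P]_w (1 * (Z w ^+ 2)%:E))%E.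
    by under [RHS]eq_integral do rewrite mul1e.
  rewrite -(change n 0%N (fun=> 1%E) (measurable_cst _) (fun=> lee01)).
  rewrite (integral_cst P measurableT 1) mul1e; exact: probability_setT.
have mtA : measurable (tail_tuple X 0 n @^-1` A).
  by rewrite -[X in measurable X]setTI; exact: mt.
apply: le_trans (probability_transport mZ Z0 EZ EZ2 eta0 mtA) _.
rewrite leeD2r// lee_wpmul2l//; first by rewrite lee_fin addr_ge0// ltW.
have mA1 : measurable_fun setT (fun t : n.-tuple 'rV[R]_d => (\1_A t : R)%:E).
  exact/measurable_EFinP.
rewrite -(change n 0%N (fun t => (\1_A t : R)%:E) mA1); last first.
  by move=> t; rewrite lee_fin.
set A2 := _ @^-1` A.
have mA2 : measurable A2 by rewrite -[X in measurable X]setTI; exact: mSt.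
by rewrite -[leRHS](_ : \int[P]_w (\1_A2 w)%:E = _)%E// integral_indic// setIT.
Qed.

(* X i is the (i+1)-st vector; f 0 and t 0 are unconstrained and play no role. *)
Theorem theorem2p1 (R : realType) (d : nat) (hd : (1 <= d)%N)
  (disp : measure_display) (T : measurableType disp) (P : probability T R)
  (X : nat -> {RV P >-> 'rV[R]_d}) (p : 'rV[R]_d -> R)
  (hp : classP p \/ classPplus p)
  (hXp : forall i, has_density (X i) p)
  (hXind : independent_seq X)
  (r : R) (hr : 0 < r)
  (f : forall n : nat, n.-tuple 'rV[R]_d -> R)
  (hfm : forall n, (1 <= n)%N -> measurable_fun [set: n.-tuple 'rV[R]_d] (f n))
  (hfh : forall n, (1 <= n)%N ->
    forall (lambda : R) (x : n.-tuple 'rV[R]_d), 0 <= lambda ->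
      f n [tuple lambda *: tnth x i | i < n] = lambda `^ r * f n x)
  (t : nat -> R) (ht : forall n, (1 <= n)%N -> 0 < t n) :
  let L := fun (n : nat) (w : T) => f n [tuple X i w | i < n] in
  (0 < limn_einf (fun n => P [set w | (t n <= L n w)%R]))%E ->
  fluctuations_at_least P L (fun n => (Num.sqrt n%:R)^-1 * t n).
Proof.
move=> L /limn_einf_gt0[c c0 cL].
have [[_ p1] [b [V [rV pE]]]] := class_regular_potential hp.
rewrite pE in p1.
have [C C0 hC] := scale_ratio_affinity rV p1.
(* The bound c' <= 1 lets terms linear in c' absorb quadratic ones. *)
pose c' := Num.min c 1.
have c'0 : 0 < c' by rewrite lt_min c0 ltr01.
have c'1 : c' <= 1 by rewrite ge_min lexx orbT.
have c'c : c' <= c by rewrite ge_min lexx.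
have C1 : 0 < 80 * (C + 1) by rewrite mulr_gt0// ltr_wpDl.
(* The step is s = alpha / sqrt n, which turns n * (C * s ^+ 2) into
   C * alpha ^+ 2; the factor 80 is large enough for the error term
   (1 + 1 / eta) * (2 * C * alpha ^+ 2) with eta = c' / 4 to be at most c' / 8. *)
have [alpha a0 aE] : exists2 alpha, 0 < alpha & alpha * (80 * (C + 1)) = c'.
  by exists (c' / (80 * (C + 1))); rewrite ?divr_gt0// divfK// gt_eqF.
have a1 : alpha <= 1 by nra.
have aC : C * alpha ^+ 2 <= c' ^+ 2 / 80.
  have : 80 * (C + 1) * alpha ^+ 2 <= c' ^+ 2.
    rewrite -aE exprMn [leLHS]mulrC; apply: ler_wpM2l; first exact: sqr_ge0.
    by rewrite expr2 ler_peMr//; lra.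
  by have := sqr_ge0 alpha; lra.
exists (r * alpha / 2), (c' / 8); split.
- by rewrite divr_gt0// mulr_gt0.
- by rewrite divr_gt0.
near=> n => x y xy.
have n1 : (1 <= n)%N by near: n; exact: nbhs_infty_ge.
have cLn : (c%:E <= P [set w | (t n <= L n w)%R])%E by near: n.
set sn := Num.sqrt n%:R => yx.
have sn1 : 1 <= sn.
  by rewrite -[leLHS](@sqrtr1 R) ler_sqrt ?ler1n// ler0n.
have sn0 : 0 < sn by lra.
have snE : sn ^+ 2 = n%:R by rewrite sqr_sqrtr// ler0n.
pose s := alpha / sn.
have s0 : 0 < s by rewrite divr_gt0.
have s1 : s <= 1 by rewrite ler_pdivrMr// mul1r; lra.
have [|h h1 hE] := hC s; first by rewrite ltW.
have ns : n%:R * (C * s ^+ 2) = C * alpha ^+ 2.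
  have n0 : (n%:R : R) != 0 by rewrite pnatr_eq0 -lt0n.
  by rewrite /s expr_div_n snE; field.
have nh : 1 - C * alpha ^+ 2 <= h ^+ n.
  have Cs : 0 <= C * s ^+ 2 <= 1.
    rewrite mulr_ge0 ?sqr_ge0//=.
    have : 1 * (C * s ^+ 2) <= n%:R * (C * s ^+ 2).
      by rewrite ler_wpM2r ?ler1n// mulr_ge0// sqr_ge0.
    rewrite ns; nra.
  rewrite -ns; apply: le_trans (bernoulli_sub n Cs) _.
  rewrite lerXn2r ?nnegrE//; move: Cs => /andP[Cs1 Cs2]; lra.
pose eta := c' / 4.
have eta0 : 0 < eta by rewrite divr_gt0.
pose A := f n @^-1` `[x, y]%classic.
have mA : measurable A.
  by rewrite -[X in measurable X]setTI; apply: hfm.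
have Xp k : has_density (X k) (cone_density b V) by rewrite -pE.
have := sample_transport hXind rV Xp hE eta0 mA.
have LE w : L n w = f n (tail_tuple X 0 n w) by [].
set A1 := _ @^-1` A; set A2 := _ @^-1` A => tr.
have mt : measurable_fun setT (tail_tuple X 0 n) by exact: measurable_tail_tuple.
have mA1 : measurable A1.
  by rewrite -[X in measurable X]setTI; exact: mt.
have mA2 : measurable A2.
  rewrite -[X in measurable X]setTI.
  apply: (measurableT_comp (@measurable_tuple_apply _ _ _ n
    (@measurable_rV_scale R d (expR s))) mt) => //.
pose A3 := [set w | (t n <= L n w)%R].
have mA3 : measurable A3.
  rewrite -[X in measurable X]setTI.
  rewrite (_ : A3 = (f n \o tail_tuple X 0 n) @^-1` `[t n, +oo[%classic).
    by apply: (measurableT_comp (hfm n n1) mt).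
  by apply/seteqP; split=> w /=; rewrite in_itv/= andbT.
have A1E : [set w | (x <= L n w <= y)%R] = A1.
  by apply/seteqP; split=> w /=; rewrite /A1 /A /= in_itv.
(* If L n and its rescaled version expR (s * r) * L n were both in [x, y] while
   L n >= t n, they would differ by at least s * r * t n > y - x. *)
have A123 : A3 `<=` ~` A1 `|` ~` A2.
  move=> w tL; apply/not_andP => -[].
  rewrite /A1 /A2 /A /= !in_itv/= => /andP[xL Ly].
  rewrite /tuple_apply hfh// ?expR_ge0// -expRM => /andP[xL' Ly'].
  move: tL; rewrite /A3 /= LE => tL.
  set l := f n _ in xL Ly xL' Ly' tL.
  have t0 := ht n n1.
  have sr : 0 < s * r by rewrite mulr_gt0.
  have h2 : s * r * t n <= (expR (s * r) - 1) * l.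
    rewrite ler_pM//; [exact: ltW|exact: ltW|].
    by have := @expR_ge1Dx R (s * r); lra.
  have h3 : y - x < s * r * t n.
    apply: le_lt_trans yx _.
    have -> : r * alpha / 2 * (sn^-1 * t n) = s * r * t n / 2.
      by rewrite /s; field; rewrite gt_eqF.
    have : 0 < s * r * t n by rewrite mulr_gt0.
    lra.
  lra.
have P3 : (P A3 <= (1 - P A1) + (1 - P A2))%E.
  rewrite -!probability_setC//.
  apply: le_trans (measureU2 _ _ _); try exact: measurableC.
  by apply: le_measure; rewrite ?inE//; apply: measurableU; exact: measurableC.
rewrite A1E.
have := le_trans cLn P3.
move: tr.
rewrite -(@fineK _ (P A1)) ?fin_num_measure// -(@fineK _ (P A2)) ?fin_num_measure//.
set q1 := fine (P A1); set q2 := fine (P A2).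
have q20 : 0 <= q2 by exact: fine_ge0.
rewrite -EFinM -EFinD -!EFinB -EFinD !lee_fin => tr q12.
have d1 : (1 + eta^-1) * (2 - 2 * h ^+ n) <= c' / 8.
  have etaV : eta^-1 * c' = 4 by rewrite /eta; field; rewrite gt_eqF.
  have e0 : 0 < eta^-1 by rewrite invr_gt0.
  apply: (@le_trans _ _ ((1 + eta^-1) * (c' ^+ 2 / 40))).
    by apply: ler_wpM2l; [lra|lra].
  have -> : (1 + eta^-1) * (c' ^+ 2 / 40) = c' ^+ 2 / 40 + (eta^-1 * c') * c' / 40.
    by ring.
  rewrite etaV; nra.
have et : eta = c' / 4 by [].
(* If q1 > 1 - c' / 8, then A123 forces q2 < 1 - c' + c' / 8, which is too
   small for the comparison tr of q1 with (1 + eta) * q2. *)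
rewrite leNgt; apply/negP => q1c.
have q2c : q2 < 1 - c' + c' / 8 by lra.
have : (1 + eta) * q2 <= (1 + eta) * (1 - c' + c' / 8) by rewrite ler_wpM2l//; lra.
move=> q2e; have : q1 <= (1 + eta) * (1 - c' + c' / 8) + c' / 8 by lra.
have -> : (1 + eta) * (1 - c' + c' / 8) = 1 - 5 / 8 * c' - 7 / 32 * c' ^+ 2.
  by rewrite et; field.
by have := sqr_ge0 c'; lra.
Unshelve. all: by end_near. Qed.
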